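(* Let $d\ge2$ and $N\ge 1$ be integers, let $m_i>0$ and let $c_i\colon\mathbb{R}\to\mathbb{R}^d$ be continuous functions, for $i=1,\dots,N$. Suppose that $$\sup_{t\in\mathbb{R}}\|c_i(t)\|<+\infty\quad\text{for every } i=1,\dots,N.$$ Then, for every $\xi^+\in\mathbb{S}^{d-1}$, there exist $R'>\sup_{t\in\mathbb{R}}\|c_i(t)\|$ (for every $i=1,\dots,N$) and $\eta'\in\mathopen]0,1\mathclose[$ such that, for every $x_0\in\mathcal{T}(\xi^+,R',\eta')$, there exists a parabolic solution $x\colon[0,+\infty[\to\mathbb{R}^d$ of $$\ddot x=-\sum_{i=1}^N\frac{m_i(x-c_i(t))}{\|x-c_i(t)\|^3}$$ satisfying $x(0)=x_0$ and $$\lim_{t\to+\infty}\frac{x(t)}{\|x(t)\|}=\xi^+.$$ Moreover, $\|x(t)\|\sim\omega t^{\frac23}$ for $t\to+\infty$, where $\omega=\sqrt[3]{\tfrac92 m}$ and $m=\sum_{i=1}^Nm_i$.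
   Context: $\|\cdot\|$ is the Euclidean norm on $\mathbb{R}^d$, $\langle\cdot,\cdot\rangle$ the Euclidean scalar product, and $\mathbb{S}^{d-1}=\{x\in\mathbb{R}^d:\|x\|=1\}$. For $R>0$ and $\eta\in\mathopen]0,1\mathclose[$, $\mathcal{T}(\xi^+,R,\eta)=\{x\in\mathbb{R}^d:\|x\|>R\text{ and }\langle x/\|x\|,\xi^+\rangle>\eta\}$. A solution $x\colon[0,+\infty[\to\mathbb{R}^d$ (a $\mathcal{C}^2$ function with $x(t)\ne c_i(t)$ for all $t$ and $i$) is called parabolic if $\lim_{t\to+\infty}\|x(t)\|=+\infty$ and $\lim_{t\to+\infty}\dot x(t)=0$. The notation $f(t)\sim g(t)$ means $f(t)/g(t)\to1$. *)

(* Defs.v *)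
From HB Require Import structures.
From mathcomp Require Import all_boot all_order all_algebra.
From mathcomp Require Import all_classical all_reals all_analysis.

Set Implicit Arguments.
Unset Strict Implicit.
Unset Printing Implicit Defensive.

Import Order.TTheory GRing.Theory Num.Theory.
Import numFieldNormedType.Exports.

Local Open Scope classical_set_scope.
Local Open Scope ring_scope.

(* The library norm `|x| on 'rV[R]_d is the sup norm, hence the explicit
   Euclidean structure below.  Limits, continuity and derivatives of
   vector-valued functions use the library topology on 'rV[R]_d, which is also
   the topology of the Euclidean norm. *)

Definition dot (R : realType) (d : nat) (x y : 'rV[R]_d) : R :=
  \sum_(k < d) x ord0 k * y ord0 k.

Definition enorm (R : realType) (d : nat) (x : 'rV[R]_d) : R :=
  Num.sqrt (dot x x).

Definition sup_enorm (R : realType) (d : nat) (c : R -> 'rV[R]_d) : \bar R :=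
  ereal_sup (range (fun t => (enorm (c t))%:E)).

Definition truncated_cone (R : realType) (d : nat)
    (xi : 'rV[R]_d) (r eta : R) : set 'rV[R]_d :=
  [set x | r < enorm x /\ eta < dot ((enorm x)^-1 *: x) xi].

(* Functions on [0, +oo[ are represented by total functions on R, whose values
   at negative times are never looked at: the derivative is relative to
   [0, +oo[, so it is the right derivative at 0. *)
Definition has_derivative_halfline (R : realType) (d : nat)
    (x x' : R -> 'rV[R]_d) : Prop :=
  forall t : R, 0 <= t ->
    (s - t)^-1 *: (x s - x t) @[s --> within `[0, +oo[ t^'] --> x' t.

Definition C2_halfline (R : realType) (d : nat)
    (x x' x'' : R -> 'rV[R]_d) : Prop :=
  [/\ has_derivative_halfline x x',
      has_derivative_halfline x' x'' &
      {within `[0, +oo[, continuous x''}].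

Definition force (R : realType) (d N : nat) (m : 'I_N -> R)
    (c : 'I_N -> R -> 'rV[R]_d) (t : R) (x : 'rV[R]_d) : 'rV[R]_d :=
  - \sum_(i < N) (m i / enorm (x - c i t) ^+ 3) *: (x - c i t).

(* x' is the velocity of x. *)
Definition solution (R : realType) (d N : nat) (m : 'I_N -> R)
    (c : 'I_N -> R -> 'rV[R]_d) (x x' : R -> 'rV[R]_d) : Prop :=
  exists x'' : R -> 'rV[R]_d,
    [/\ C2_halfline x x' x'',
        forall (t : R) (i : 'I_N), 0 <= t -> x t <> c i t &
        forall t : R, 0 <= t -> x'' t = force m c t (x t)].

Definition parabolic_solution (R : realType) (d N : nat) (m : 'I_N -> R)
    (c : 'I_N -> R -> 'rV[R]_d) (x : R -> 'rV[R]_d) : Prop :=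
  exists x' : R -> 'rV[R]_d,
    [/\ solution m c x x',
        enorm (x t) @[t --> +oo] --> +oo &
        x' t @[t --> +oo] --> (0 : 'rV[R]_d)].

Definition asymp_equiv (R : realType) (f g : R -> R) : Prop :=
  f t / g t @[t --> +oo] --> (1 : R).

(* Main.v *)
Require Import Defs.
From HB Require Import structures.
From mathcomp Require Import all_boot all_order all_algebra.
From mathcomp Require Import all_classical all_reals all_analysis.
From mathcomp Require Import ring lra.

(** The attraction of bounded centres is, far away, a perturbation of a single
    Kepler centre of mass [m] at the origin, for which the half-line spanned by
    [xi] carries the homothetic parabolic motion [omega (t + T)^(2/3) xi].  The
    solutions are obtained as perturbations of this one.

    Let [r] be the norm of the initial position and choose [T] so that the
    homothetic motion has norm [r] at time [0], that is, [r^3 = (9/2) m T^2].  In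
    the variable [w = (1 + t / T)^(-1/3)], which runs from [1] to [0] as [t]
    runs from [0] to [+oo], write [x = r w^-2 (xi + v w)].  Newton's equation
    becomes
<<
      w^2 v'' = 2 (xi + v - sum_i (m_i / m) F (xi + v - w^2 c_i / r)),
>>
    where [F y = y / |y|^3], and the requirements are [v 1 = x(0) / r - xi] and
    [v = O(w)] at [0].  Fractional powers have disappeared, and infinity
    is an endpoint.

    Expanding [F] at [xi], the linear part is [w^2 v'' = 6 <v, xi> xi].  Its
    solutions are [1] and [w] orthogonally to [xi], and [w^3] and [w^-2] along
    [xi]; in each case exactly one is [O(w)], so the inhomogeneous linear problem
    with value [b] at [1] has an explicit solution, bounded by a multiple of
    [(|b| + sup |f|) w] when the source is [w^2 f]
    ([vector_sol_bound]).  The nonlinear source is [w^2 f] with [f] bounded: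
    the remainder of [F] is quadratic in [O(w)] quantities
    ([kepler_rem_lipschitz]), and the centres enter with the factor [w^2].  Hence
    the nonlinear problem is a fixed point problem for a contraction of a small
    ball for the norm [sup |v w| / w] ([reduced_problem]), provided that [1 / r]
    and the angle between the initial position and [xi] are small.  This is
    the choice of the radius and of the aperture of the cone.

    Going back to the time [t], [v w -> 0] as [w -> 0] gives the asymptotic
    direction [xi] and the equivalent of the norm, and the bound on [v'] gives
    the vanishing of the velocity ([parabolic_solution_of_profile]). *)

Set Implicit Arguments.
Unset Strict Implicit.

Import Order.TTheory GRing.Theory Num.Theory.
Import numFieldNormedType.Exports.

Local Open Scope classical_set_scope.
Local Open Scope ring_scope.

(** * Primitives of functions that may oscillate at the origin *)

HB.lock Definition prim {R : realType} (f : R -> R) (x : R) : R :=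
  \int[@lebesgue_measure R]_(t in `]0, x]) f t.

Section Primitive.
Context {R : realType}.
Implicit Types (f g : R -> R) (x w K : R).
Notation mu := (@lebesgue_measure R).

(** The endpoint [w = 0] stands for the time [+oo], where the moving centres
    have no limit.  The sources met below are therefore continuous on
    [0 < w] only, and bounded near [0]. *)
Definition admissible f :=
  (forall w, 0 < w -> {for w, continuous f}) /\
  (forall M, exists K, forall w, 0 < w <= M -> `|f w| <= K).

Lemma lebesgue_measure_oc x : 0 < x -> mu (`]0%R, x]%classic : set R) = x%:E.
Proof. by move=> x0; rewrite lebesgue_measure_itv/= lte_fin x0 oppr0 adde0. Qed.

Lemma lebesgue_measure_oc_lty x : (mu (`]0%R, x]%classic : set R) < +oo)%E.
Proof.
by rewrite lebesgue_measure_itv/=; case: ifP => _; rewrite -?EFinB ltry.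
Qed.

Lemma admissible_integrable f x : admissible f ->
  mu.-integrable `]0, x] (EFin \o f).
Proof.
move=> [fc fb]; apply: measurable_bounded_integrable => //.
- exact: lebesgue_measure_oc_lty.
- apply: (@measurable_funS _ _ _ _ (`]0%R, +oo[%classic : set R)) => //.
    by move=> z /=; rewrite !in_itv/= => /andP[->].
  apply: measurable_realfun.open_continuous_measurable_fun; first exact: interval_open.
  by move=> z; rewrite inE/= in_itv/= andbT; exact: fc.
- have [K fK] := fb x; exists `|K|; split; first exact: normr_real.
  move=> y Ky z /=; rewrite in_itv/= => /fK fz.
  by rewrite (le_trans fz)// (le_trans (ler_norm K))// ltW.
Qed.

Lemma is_derive_prim f x : admissible f -> 0 < x -> is_derive x 1 (prim f) (f x).
Proof.
move=> af x0; have xx1 : x < x + 1 by rewrite ltrDl.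
have x0' : (BRight 0 < BRight x)%O by [].
have [] := continuous_FTC1 xx1 (admissible_integrable (x + 1) af) x0' (af.1 x x0).
have primE : prim f = (fun y => \int[mu]_(t in `]0, y]) f t) by rewrite prim.unlock.
by rewrite -primE derive1E => df dfE; exact: DeriveDef df dfE.
Qed.

Lemma admissible_cst K : admissible (fun=> K).
Proof. by split=> [w _|M]; [exact: cvg_cst|exists `|K|]. Qed.

Lemma prim_bound f x K : admissible f -> 0 < x ->
  (forall w, 0 < w <= x -> `|f w| <= K) -> `|prim f x| <= K * x.
Proof.
move=> af x0 fK; have intf := admissible_integrable x af.
rewrite prim.unlock; apply: (le_trans (le_normr_Rintegral _ _)) => //.
have -> : K * x = \int[mu]_(t in `]0, x]) K.
  by rewrite Rintegral_cst//= lebesgue_measure_oc.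
apply: le_Rintegral => //.
- exact: integrable_norm.
- exact: (admissible_integrable _ (admissible_cst K)).

Qed.

Lemma is_derive_continuous f w (df : R) :
  is_derive w 1 f df -> {for w, continuous f}.
Proof. by move=> d; exact/differentiable_continuous/derivable1_diffP. Qed.

Lemma admissible_prim f : admissible f -> admissible (prim f).
Proof.
move=> af; split=> [w w0|M].
  exact: is_derive_continuous (is_derive_prim af w0).
have [K fK] := af.2 M; exists (`|K| * M) => w /andP[w0 wM].
have K0 : 0 <= K by rewrite (le_trans _ (fK _ (introT andP (conj w0 wM)))).
rewrite (ger0_norm K0); apply: (le_trans (prim_bound af w0 (K := K) _)).
  by move=> z /andP[z0 zw]; rewrite fK// z0 (le_trans zw).
by rewrite ler_wpM2l.
Qed.

Lemma admissibleZ k f : admissible f -> admissible (fun w => k * f w).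
Proof.
move=> [fc fb]; split=> [w w0|M]; first by apply: cvgM; [exact: cvg_cst|exact: fc].
have [K fK] := fb M; exists (`|k| * K) => w /fK fwK.
by rewrite normrM ler_wpM2l.
Qed.

Lemma admissibleD f g : admissible f -> admissible g ->
  admissible (fun w => f w + g w).
Proof.
move=> [fc fb] [gc gb]; split=> [w w0|M]; first by apply: cvgD; [exact: fc|exact: gc].
have [K fK] := fb M; have [L gL] := gb M; exists (K + L) => w wM.
by rewrite (le_trans (ler_normD _ _))// lerD ?fK ?gL.
Qed.

Lemma admissibleM f g : admissible f -> admissible g ->
  admissible (fun w => f w * g w).
Proof.
move=> [fc fb] [gc gb]; split=> [w w0|M]; first by apply: cvgM; [exact: fc|exact: gc].
have [K fK] := fb M; have [L gL] := gb M; exists (K * L) => w wM.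
by rewrite normrM ler_pM ?fK ?gL.
Qed.

Lemma primZ k f x : admissible f -> prim (fun w => k * f w) x = k * prim f x.
Proof. by move=> af; rewrite prim.unlock RintegralZl//; exact: admissible_integrable. Qed.

Lemma primD f g x : admissible f -> admissible g ->
  prim (fun w => f w + g w) x = prim f x + prim g x.
Proof. by move=> af ag; rewrite prim.unlock RintegralD//; exact: admissible_integrable. Qed.

End Primitive.

(** * Derivation rules for real functions given by their values *)
Section PointwiseDerivatives.
Context {R : realType}.
Implicit Types (f g : R -> R) (x a b : R).

Lemma is_derive1D f g x a b : is_derive x 1 f a -> is_derive x 1 g b ->
  is_derive x 1 (fun y => f y + g y) (a + b).
Proof. exact: is_deriveD. Qed.

Lemma is_derive1B f g x a b : is_derive x 1 f a -> is_derive x 1 g b ->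
  is_derive x 1 (fun y => f y - g y) (a - b).
Proof. exact: is_deriveB. Qed.

Lemma is_derive1M f g x a b : is_derive x 1 f a -> is_derive x 1 g b ->
  is_derive x 1 (fun y => f y * g y) (f x * b + g x * a).
Proof. exact: is_deriveM. Qed.

Lemma is_derive1Z f k x a : is_derive x 1 f a ->
  is_derive x 1 (fun y => k * f y) (k * a).
Proof. exact: is_deriveZ. Qed.

Lemma is_derive1Mr f k x a : is_derive x 1 f a ->
  is_derive x 1 (fun y => f y * k) (a * k).
Proof.
move=> d; under eq_fun do rewrite mulrC.
by rewrite mulrC; exact: is_derive1Z.
Qed.

Lemma is_derive1X f n x a : is_derive x 1 f a ->
  is_derive x 1 (fun y => f y ^+ n) (n%:R * f x ^+ n.-1 * a).
Proof.
move=> d; have := is_deriveX n d.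
suff -> : f ^+ n = (fun y => f y ^+ n) by [].
by rewrite exprfctE.
Qed.

Lemma is_derive1V f x a : f x != 0 -> is_derive x 1 f a ->
  is_derive x 1 (fun y => (f y)^-1) (- (f x) ^- 2 * a).
Proof. exact: is_deriveV. Qed.

Lemma is_derive1_congr f x a b : is_derive x 1 f a -> a = b -> is_derive x 1 f b.
Proof. by move=> d <-. Qed.
End PointwiseDerivatives.

(** * The linearized equation, tangential and radial parts *)
Section LinearSolvers.
Context {R : realType}.
Implicit Types (f g : R -> R) (a b w K B : R).

(** The solution of [v'' = f] that vanishes at [0] and equals [b] at [1].
    Orthogonally to [xi] the linearized equation reads [w^2 v'' = w^2 f]. *)
Definition free_sol f b w := w * b + prim (prim f) w - w * prim (prim f) 1.
Definition free_vel f b w := b + prim f w - prim (prim f) 1.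

(** Along [xi] the linearized equation reads [w^2 v'' = 6 v + w^2 g], with
    homogeneous solutions [w^3] and [w^-2].  This is the particular solution
    given by variation of constants.  The term [w^3] times the integral of
    [u^-2 g(u)] over [w <= u] is computed by the substitution [z = 1 / u],
    which turns it into a primitive from [0]. *)
Definition radial_part g w :=
  - 5^-1 * (w ^+ 3 * prim (fun u => g u^-1) w^-1
            + w ^- 2 * prim (fun u => u ^+ 3 * g u) w).
Definition radial_part_vel g w :=
  - 5^-1 * (3 * w ^+ 2 * prim (fun u => g u^-1) w^-1
            - 2 * w ^- 3 * prim (fun u => u ^+ 3 * g u) w).
(** The boundary value at [1] is adjusted with [w^3] alone: [w^-2] would
    be unbounded at [0]. *)
Definition radial_sol g a w :=
  radial_part g w + w ^+ 3 * (a - radial_part g 1).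
Definition radial_vel g a w :=
  radial_part_vel g w + 3 * w ^+ 2 * (a - radial_part g 1).

(** Boundedness holds on the whole half-line, so that [u |-> g (1 / u)] is
    bounded near [0] as well. *)
Definition bounded_source g :=
  (forall w, 0 < w -> {for w, continuous g}) /\
  (exists K, forall w, 0 < w -> `|g w| <= K).

Lemma bounded_source_admissible g : bounded_source g -> admissible g.
Proof.
by case=> gc [K gK]; split=> // M; exists K => w /andP[w0 _]; exact: gK.
Qed.

Lemma bounded_source_inv g : bounded_source g -> admissible (fun u => g u^-1).
Proof.
case=> gc [K gK]; split=> [w w0|M]; last first.
  by exists K => w /andP[w0 _]; rewrite gK ?invr_gt0.
apply: (@cvg_comp _ _ _ (@GRing.inv R) g); last by apply: gc; rewrite invr_gt0.
by apply: cvgV; [rewrite gt_eqF|exact: cvg_id].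
Qed.

Lemma admissible_expM n g : admissible g -> admissible (fun u => u ^+ n * g u).
Proof.
apply: admissibleM; split=> [w w0|M]; first exact: exprn_continuous.
exists (M ^+ n) => w /andP[w0 wM]; rewrite normrX gtr0_norm//.
by rewrite lerXn2r// ?nnegrE ?(ltW w0)// (le_trans (ltW w0)).
Qed.

Lemma free_sol1 f b : free_sol f b 1 = b.
Proof. by rewrite /free_sol; ring. Qed.

Lemma radial_sol1 g a : radial_sol g a 1 = a.
Proof. by rewrite /radial_sol; ring. Qed.

Lemma is_derive_free_sol f b w : admissible f -> 0 < w ->
  is_derive w 1 (free_sol f b) (free_vel f b w).
Proof.
move=> af w0; have dP := is_derive_prim (admissible_prim af) w0.
have dw := is_derive_id w (1 : R).
apply: (is_derive1_congr (is_derive1B (is_derive1D (is_derive1Mr b dw) dP)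
  (is_derive1Mr (prim (prim f) 1) dw))).
by rewrite /free_vel; ring.
Qed.

Lemma is_derive_free_vel f b w : admissible f -> 0 < w ->
  is_derive w 1 (free_vel f b) (f w).
Proof.
move=> af w0; have dc k := is_derive_cst (k : R) w (1 : R).
apply: (is_derive1_congr (is_derive1B (is_derive1D (dc b) (is_derive_prim af w0))
  (dc (prim (prim f) 1)))).
by ring.
Qed.

Lemma is_derive_prim_inv g w : bounded_source g -> 0 < w ->
  is_derive w 1 (fun u => prim (fun z => g z^-1) u^-1) (- w ^- 2 * g w).
Proof.
move=> bg w0; have wN0 : w != 0 by rewrite gt_eqF.
have dP : is_derive w^-1 1 (prim (fun z => g z^-1)) (g w^-1^-1).
  by apply: is_derive_prim; [exact: bounded_source_inv|rewrite invr_gt0].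
have dV := is_derive1V (f := id) wN0 (is_derive_id w (1 : R)).
apply: (is_derive1_congr (is_derive1_comp dP dV)).
by rewrite invrK; ring.
Qed.

Lemma is_derive_prim_pow g n w : bounded_source g -> 0 < w ->
  is_derive w 1 (prim (fun u => u ^+ n * g u)) (w ^+ n * g w).
Proof.
move=> bg w0; apply: (is_derive_prim (f := fun u => u ^+ n * g u)) => //.
by apply: admissible_expM; exact: bounded_source_admissible.
Qed.

Lemma is_derive_radial_sol g a w : bounded_source g -> 0 < w ->
  is_derive w 1 (radial_sol g a) (radial_vel g a w).
Proof.
move=> bg w0; have wN0 : w != 0 by rewrite gt_eqF.
have dX n := is_derive1X n (is_derive_id w (1 : R)).
have dV := is_derive1V (f := fun u => u ^+ 2) (expf_neq0 2 wN0) (dX 2%N).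
have dA := is_derive1M (dX 3%N) (is_derive_prim_inv bg w0).
have dB := is_derive1M dV (is_derive_prim_pow 3 bg w0).
apply: (is_derive1_congr (is_derive1D (is_derive1Z (- 5^-1) (is_derive1D dA dB))
  (is_derive1Mr (a - radial_part g 1) (dX 3%N)))).
by rewrite /radial_vel /radial_part_vel /=; field.
Qed.

Lemma is_derive_radial_vel g a w : bounded_source g -> 0 < w ->
  is_derive w 1 (radial_vel g a) (6 * w ^- 2 * radial_sol g a w + g w).
Proof.
move=> bg w0; have wN0 : w != 0 by rewrite gt_eqF.
have dX n := is_derive1X n (is_derive_id w (1 : R)).
have dV := is_derive1V (f := fun u => u ^+ 3) (expf_neq0 3 wN0) (dX 3%N).
have dA := is_derive1M (is_derive1Z 3 (dX 2%N)) (is_derive_prim_inv bg w0).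
have dB := is_derive1M (is_derive1Z 2 dV) (is_derive_prim_pow 3 bg w0).
apply: (is_derive1_congr (is_derive1D (is_derive1Z (- 5^-1) (is_derive1B dA dB))
  (is_derive1Mr (a - radial_part g 1) (is_derive1Z 3 (dX 2%N))))).
by rewrite /radial_sol /radial_part /=; field.
Qed.
End LinearSolvers.

(** * Linearity and weighted bounds for the linear solvers *)
Section SolverBounds.
Context {R : realType}.
Implicit Types (f g : R -> R) (a b w K B : R).

Lemma prim_linear k f g w : admissible f -> admissible g ->
  prim (fun u => k * f u + g u) w = k * prim f w + prim g w.
Proof.
move=> af ag; rewrite (primD (f := fun u => k * f u))//; last exact: admissibleZ.
by rewrite primZ.
Qed.

Lemma free_sol_linear k f g b c w : admissible f -> admissible g ->
  free_sol (fun u => k * f u + g u) (k * b + c) w =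
  k * free_sol f b w + free_sol g c w.
Proof.
move=> af ag; rewrite /free_sol.
have -> : prim (fun u => k * f u + g u) = (fun u => k * prim f u + prim g u).
  by apply/funext => u; exact: prim_linear.
have lin u := prim_linear k u (admissible_prim af) (admissible_prim ag).
by rewrite (lin w) (lin 1); ring.
Qed.

Lemma radial_sol_linear k f g a b w : bounded_source f -> bounded_source g ->
  radial_sol (fun u => k * f u + g u) (k * a + b) w =
  k * radial_sol f a w + radial_sol g b w.
Proof.
move=> bf bg.
have lin u : radial_part (fun u => k * f u + g u) u =
    k * radial_part f u + radial_part g u.
  rewrite /radial_part.
  rewrite (prim_linear k u^-1 (bounded_source_inv bf) (bounded_source_inv bg)).
  have af := admissible_expM 3 (bounded_source_admissible bf).
  have ag := admissible_expM 3 (bounded_source_admissible bg).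
  have -> : (fun z => z ^+ 3 * (k * f z + g z)) =
      (fun z => k * (z ^+ 3 * f z) + z ^+ 3 * g z).
    by apply/funext => z; ring.
  rewrite (prim_linear k u af ag); ring.
by rewrite /radial_sol !lin; ring.
Qed.

Lemma free_sol_sum (I : Type) (s : seq I) (F : I -> R -> R) (k b : I -> R) w :
  (forall i, admissible (F i)) ->
  free_sol (fun u => \sum_(i <- s) k i * F i u) (\sum_(i <- s) k i * b i) w =
  \sum_(i <- s) k i * free_sol (F i) (b i) w.
Proof.
move=> aF.
have aS r : admissible (fun u => \sum_(i <- r) k i * F i u).
  elim: r => [|i r ih].
    by under eq_fun do rewrite big_nil; exact: admissible_cst.
  under eq_fun do rewrite big_cons.
  by apply: admissibleD => //; exact: admissibleZ.
elim: s => [|i s ih]; last first.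
  rewrite !big_cons -ih -(free_sol_linear (k i) (b i) _ w (aF i) (aS s)).
  congr (free_sol _ _ w).
  by apply/funext => u; rewrite big_cons.
under eq_fun do rewrite big_nil; rewrite !big_nil.
have az := @admissible_cst R 0.
have -> : free_sol (fun=> 0) 0 w =
    -1 * free_sol (fun=> 0) 0 w + free_sol (fun=> 0) 0 w.
  rewrite -(free_sol_linear (-1) 0 0 w az az).
  by congr (free_sol _ _ w); [apply/funext => u|]; ring.
by ring.
Qed.

(** A bounded source integrates twice to [O(w^2)], so the boundary terms,
    linear in [w], dominate on [0 < w <= 1]. *)
Lemma free_sol_bound f b K B w : admissible f ->
  (forall u, 0 < u <= 1 -> `|f u| <= K) -> `|b| <= B -> 0 < w <= 1 ->
  `|free_sol f b w| <= (B + 2 * K) * w /\ `|free_vel f b w| <= B + 2 * K.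
Proof.
move=> af fK bB /andP[w0 w1].
have bP u : 0 < u <= 1 -> `|prim f u| <= K * u.
  move=> /andP[u0 u1]; apply: prim_bound => // z /andP[z0 zu].
  by rewrite fK// z0 (le_trans zu).
have K0 : 0 <= K by rewrite (le_trans _ (fK 1 _))// ltr01 lexx.
have bPP u : 0 < u <= 1 -> `|prim (prim f) u| <= K * u.
  move=> /andP[u0 u1]; apply: prim_bound => //; first exact: admissible_prim.
  move=> z /andP[z0 zu]; rewrite (le_trans (bP z _)) ?z0 ?(le_trans zu)//.
  by rewrite ler_piMr// (le_trans zu).
have w01 : 0 < w <= 1 by rewrite w0.
have one : 0 < (1 : R) <= 1 by rewrite ltr01 lexx.
have := bPP _ one; rewrite mulr1 => h1; have h2 := bPP _ w01; have h3 := bP _ w01.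
split.
  rewrite (le_trans (ler_normB _ _))// (le_trans (lerD (ler_normD _ _) (lexx _)))//.
  rewrite !normrM (gtr0_norm w0).
  have := ler_wpM2l (ltW w0) h1; have := ler_wpM2l (ltW w0) bB; lra.
rewrite (le_trans (ler_normB _ _))// (le_trans (lerD (ler_normD _ _) (lexx _)))//.
have : K * w <= K by rewrite ler_piMr.
by lra.
Qed.

(** The first term of the variation of constants formula is at most
    [w^3 (K / w)] and the second at most [w^-2 (K w^4)]: the singular solution
    [w^-2] meets an integral that vanishes faster. *)
Lemma radial_part_bound g K w : bounded_source g ->
  (forall u, 0 < u -> `|g u| <= K) -> 0 < w <= 1 ->
  `|radial_part g w| <= K * w /\ `|radial_part_vel g w| <= K.
Proof.
move=> bg gK /andP[w0 w1]; have wN0 : w != 0 by rewrite gt_eqF.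
have K0 : 0 <= K by rewrite (le_trans _ (gK 1 _)).
have hA : `|prim (fun u => g u^-1) w^-1| <= K * w^-1.
  apply: prim_bound; [exact: bounded_source_inv|by rewrite invr_gt0|].
  by move=> u /andP[u0 _]; rewrite gK ?invr_gt0.
have hB : `|prim (fun u => u ^+ 3 * g u) w| <= K * w ^+ 3 * w.
  apply: prim_bound => //.
    by apply: admissible_expM; exact: bounded_source_admissible.
  move=> u /andP[u0 uw]; rewrite normrM normrX gtr0_norm// mulrC.
  by rewrite ler_pM ?exprn_ge0 ?gK ?(ltW u0)// lerXn2r// nnegrE ltW.
have n5 : `|- 5^-1 : R| = 5^-1 by rewrite normrN gtr0_norm.
have w2 : w ^+ 2 <= w by rewrite expr2 ler_piMl// ltW.
have Kw2 := ler_wpM2l K0 w2; have Kw := ler_wpM2l K0 w1.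
rewrite mulr1 in Kw.
have h1 : w ^+ 3 * (K * w^-1) = K * w ^+ 2 by field.
have h2 : w ^- 2 * (K * w ^+ 3 * w) = K * w ^+ 2 by field.
have h3 : w ^+ 2 * (K * w^-1) = K * w by field.
have h4 : w ^- 3 * (K * w ^+ 3 * w) = K * w by field.
have Aw n : w ^+ n * `|prim (fun u => g u^-1) w^-1| <= w ^+ n * (K * w^-1).
  by rewrite ler_wpM2l// exprn_ge0// ltW.
have Bw n : w ^- n * `|prim (fun u => u ^+ 3 * g u) w| <= w ^- n * (K * w ^+ 3 * w).
  by rewrite ler_wpM2l// invr_ge0 exprn_ge0// ltW.
have pw n : `|w ^+ n| = w ^+ n by rewrite ger0_norm// exprn_ge0// ltW.
have pV n : `|w ^- n| = w ^- n by rewrite ger0_norm// invr_ge0 exprn_ge0// ltW.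
have := (Aw 3%N, Bw 2%N, Aw 2%N, Bw 3%N).
rewrite h1 h2 h3 h4 => -[[[a3 b2] a2] b3].
split; rewrite normrM n5.
  have := ler_normD (w ^+ 3 * prim (fun u => g u^-1) w^-1)
    (w ^- 2 * prim (fun u => u ^+ 3 * g u) w).
  by rewrite (normrM (w ^+ 3)) (normrM (w ^- 2)) pw pV; have := mulr_ge0 K0 (ltW w0); lra.
have := ler_normB (3 * w ^+ 2 * prim (fun u => g u^-1) w^-1)
  (2 * w ^- 3 * prim (fun u => u ^+ 3 * g u) w).
rewrite (normrM (3 * _)) (normrM (2 * _)) (normrM 3) (normrM 2) pw pV.
rewrite (gtr0_norm (ltr0Sn R 2)) (gtr0_norm (ltr0Sn R 1)).
by lra.
Qed.

Lemma radial_sol_bound g a K B w : bounded_source g ->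
  (forall u, 0 < u -> `|g u| <= K) -> `|a| <= B -> 0 < w <= 1 ->
  `|radial_sol g a w| <= (B + 2 * K) * w /\
  `|radial_vel g a w| <= 3 * B + 4 * K.
Proof.
move=> bg gK aB /andP[w0 w1].
have one : 0 < (1 : R) <= 1 by rewrite ltr01 lexx.
have w01 : 0 < w <= 1 by rewrite w0.
have [p1 _] := radial_part_bound bg gK one; rewrite mulr1 in p1.
have [pw vw] := radial_part_bound bg gK w01.
have B0 : 0 <= B by rewrite (le_trans _ aB).
have K0 : 0 <= K by rewrite (le_trans _ (gK 1 _)).
have hc : `|a - radial_part g 1| <= B + K.
  by rewrite (le_trans (ler_normB _ _))// lerD.
have w2 : w ^+ 2 <= 1 by rewrite exprn_ile1// ltW.
have w3 : w ^+ 3 <= w by rewrite exprS ler_piMr// ltW.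
have pn n : `|w ^+ n| = w ^+ n by rewrite ger0_norm// exprn_ge0// ltW.
split; rewrite (le_trans (ler_normD _ _))//.
  rewrite (normrM (w ^+ 3)) pn.
  have : w ^+ 3 * `|a - radial_part g 1| <= w * (B + K).
    by rewrite ler_pM// exprn_ge0// ltW.
  by lra.
have : w ^+ 2 * `|a - radial_part g 1| <= 1 * (B + K).
  by rewrite ler_pM// exprn_ge0// ltW.
rewrite (normrM (3 * _)) (normrM 3) pn (gtr0_norm (ltr0Sn R 2)).
by lra.
Qed.
End SolverBounds.

(** * Comparison of the Euclidean and the sup norms *)
Section EuclideanStructure.
Context {R : realType} {d : nat}.
Implicit Types (x y z h k : 'rV[R]_d) (a K : R).

Lemma coord_le_norm x j : `|x ord0 j| <= `|x|.
Proof.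
rewrite [leRHS]/Num.Def.normr/= mx_normrE.
exact: (le_bigmax _ (fun ij : 'I_1 * 'I_d => `|x ij.1 ij.2|) (ord0, j)).
Qed.

Lemma norm_le_coord x K : 0 <= K -> (forall j, `|x ord0 j| <= K) -> `|x| <= K.
Proof.
move=> K0 xK; rewrite [leLHS]/Num.Def.normr/= mx_normrE bigmax_le//.
by move=> -[i j] _ /=; rewrite ord1.
Qed.

Lemma dotC x y : dot x y = dot y x.
Proof. by apply: eq_bigr => j _; rewrite mulrC. Qed.

Lemma dotDl x y z : dot (x + y) z = dot x z + dot y z.
Proof. by rewrite -big_split; apply: eq_bigr => j _; rewrite mxE mulrDl. Qed.

Lemma dotZl a x y : dot (a *: x) y = a * dot x y.
Proof. by rewrite [RHS]mulr_sumr; apply: eq_bigr => j _; rewrite mxE mulrA. Qed.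

Lemma dotNl x y : dot (- x) y = - dot x y.
Proof. by rewrite -scaleN1r dotZl mulN1r. Qed.

Lemma dotDr x y z : dot x (y + z) = dot x y + dot x z.
Proof. by rewrite dotC dotDl dotC [dot z _]dotC. Qed.

Lemma dotZr a x y : dot x (a *: y) = a * dot x y.
Proof. by rewrite dotC dotZl dotC. Qed.

Lemma dotNr x y : dot x (- y) = - dot x y.
Proof. by rewrite dotC dotNl dotC. Qed.

Definition dotE := (dotDl, dotDr, dotZl, dotZr, dotNl, dotNr).

Lemma dot_ge0 x : 0 <= dot x x.
Proof. by apply: sumr_ge0 => j _; rewrite -expr2 sqr_ge0. Qed.

Lemma enorm_sqr x : enorm x ^+ 2 = dot x x.
Proof. by rewrite sqr_sqrtr// dot_ge0. Qed.

Lemma dot_le_norm x y : `|dot x y| <= d%:R * (`|x| * `|y|).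
Proof.
rewrite (le_trans (ler_norm_sum _ _ _))//.
rewrite (le_trans (ler_sum _ (G := fun=> `|x| * `|y|) _))//.
  by move=> j _; rewrite normrM ler_pM ?coord_le_norm.
by rewrite sumr_const card_ord mulr_natl.
Qed.

Lemma norm_le_enorm x : `|x| <= enorm x.
Proof.
apply: norm_le_coord; first exact: sqrtr_ge0.
move=> j; rewrite -ler_sqr ?nnegrE ?sqrtr_ge0// enorm_sqr real_normK ?num_real//.
rewrite /dot (bigD1 j)//= -expr2 lerDl sumr_ge0// => i _.
by rewrite -expr2 sqr_ge0.
Qed.

Lemma enormZ a x : enorm (a *: x) = `|a| * enorm x.
Proof. by rewrite /enorm dotZl dotZr mulrA -expr2 sqrtrM ?sqr_ge0// sqrtr_sqr. Qed.

Lemma dot_gt0_neq0 x : 0 < dot x x -> x != 0.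
Proof.
apply: contraTneq => ->; rewrite /dot big1 ?ltxx// => j _.
by rewrite mxE mul0r.
Qed.

Lemma cvg_dot (T : Type) (F : set_system T) {FF : Filter F}
    (f g : T -> 'rV[R]_d) x y :
  f t @[t --> F] --> x -> g t @[t --> F] --> y ->
  dot (f t) (g t) @[t --> F] --> dot x y.
Proof.
move=> fx gy; apply: (@cvg_big R 'I_d +%R 0 xpredT add_continuous T F _
  (fun j t => f t ord0 j * g t ord0 j) (fun j => x ord0 j * y ord0 j)).
move=> j _; apply: cvgM.
- exact: (@cvg_comp _ _ _ f (fun u : 'rV[R]_d => u ord0 j) _ _ _ fx
    (@coord_continuous _ _ _ ord0 j x)).
- exact: (@cvg_comp _ _ _ g (fun u : 'rV[R]_d => u ord0 j) _ _ _ gy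
    (@coord_continuous _ _ _ ord0 j y)).
Qed.

Lemma enorm_continuous : continuous (@enorm R d).
Proof.
move=> x; apply: (@continuous_comp _ _ _ (fun x => dot x x) Num.sqrt).
  exact: (@cvg_dot _ (nbhs x) _ id id x x).

exact: sqrt_continuous.
Qed.

Lemma cvg_rV (T : Type) (F : set_system T) {FF : Filter F} (f : T -> 'rV[R]_d) x :
  (forall j, f t ord0 j @[t --> F] --> x ord0 j) -> f t @[t --> F] --> x.
Proof.
move=> fx; apply/cvgrPdist_le => e e0; near=> t.
apply: norm_le_coord; first exact: ltW.
move=> j; rewrite !mxE; move: j; near: t; apply: filter_forall => j.
by have /cvgrPdist_le := fx j; apply.
Unshelve. all: by end_near. Qed.
End EuclideanStructure.

(** * Second order estimate for the Kepler field at a unit vector *)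
Section KeplerLinearization.
Context {R : realType}.
Implicit Types (s t e : R).

(** The function [s^(-3/2)], by which the Kepler field multiplies a vector of
    squared norm [s]. *)
Definition invcube s : R := (Num.sqrt s ^+ 3)^-1.

Lemma normM_le (x y a b : R) : `|x| <= a -> `|y| <= b -> `|x * y| <= a * b.
Proof. by move=> xa yb; rewrite normrM ler_pM. Qed.

Lemma normD_le (x y a b : R) : `|x| <= a -> `|y| <= b -> `|x + y| <= a + b.
Proof. by move=> xa yb; rewrite (le_trans (ler_normD _ _))// lerD. Qed.

(** With [b = s^(-1/2)], expressions in [s^(-3/2)] become polynomials in [b],
    and [s] is recovered from [b^2 s = 1]. *)
Lemma invsqrt_near1 s e : e <= 2^-1 -> `|s - 1| <= e ->
  exists b, [/\ 0 < b, b ^+ 2 * s = 1, invcube s = b ^+ 3,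
    `|b - 1| <= 2 * e & `|b ^+ 2 - 1| <= 2 * e] /\ 2^-1 <= b <= 3 / 2.
Proof.
move=> e2 se; have [s1 s2] : 2^-1 <= s /\ s <= 3 / 2.
  by move: se; rewrite ler_norml => /andP[]; lra.
have s0 : 0 < s by lra.
have q0 : 0 < Num.sqrt s by rewrite sqrtr_gt0.
have b0 : 0 < (Num.sqrt s)^-1 by rewrite invr_gt0.
have bs : (Num.sqrt s)^-1 ^+ 2 * s = 1.
  by rewrite exprVn sqr_sqrtr ?(ltW s0)// mulVf// gt_eqF.
exists (Num.sqrt s)^-1; move: b0 bs; rewrite /invcube -exprVn.
move: (Num.sqrt s)^-1 => b b0 bs.
have b2 : b ^+ 2 <= 2.
  have : 0 <= b ^+ 2 * (s - 2^-1) by rewrite mulr_ge0 ?sqr_ge0 ?subr_ge0.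
  by rewrite mulrBr bs; lra.
have b3 : 2 / 3 <= b ^+ 2.
  have : 0 <= b ^+ 2 * (3 / 2 - s) by rewrite mulr_ge0 ?sqr_ge0 ?subr_ge0.
  by rewrite mulrBr bs; lra.
have hb2 : `|b ^+ 2 - 1| <= 2 * e.
  have -> : b ^+ 2 - 1 = b ^+ 2 * (1 - s) by rewrite mulrBr bs mulr1.
  apply: normM_le; first by rewrite ger0_norm ?sqr_ge0.
  by rewrite distrC.
split; first split=> //.
- have hb : `|b - 1| * (b + 1) = `|b ^+ 2 - 1|.
    rewrite -[b + 1]gtr0_norm ?addr_gt0// -normrM; congr `|_|; ring.
  rewrite (le_trans _ hb2)// -hb ler_peMr//; lra.
- apply/andP; split; rewrite leNgt; apply/negP => hb.
    have : b ^+ 2 < 2^-1 ^+ 2 by rewrite ltrXn2r// ?nnegrE ltW.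
    by lra.
  have : (3 / 2) ^+ 2 < b ^+ 2 by rewrite ltrXn2r// nnegrE ltW.
  by lra.
Qed.

Lemma invcube_near1 s e : e <= 2^-1 -> `|s - 1| <= e -> `|invcube s - 1| <= 10 * e.
Proof.
move=> e2 se; have [b [[b0 _ -> b1 _] /andP[_ b2]]] := invsqrt_near1 e2 se.
have -> : b ^+ 3 - 1 = (b - 1) * (b * b + b + 1) by ring.
have nb : `|b| <= 3 / 2 by rewrite gtr0_norm.
have := normM_le b1 (normD_le (normD_le (normM_le nb nb) nb)
  (_ : `|1| <= 1)); rewrite normr1 => /(_ (lexx _)).
have := le_trans (normr_ge0 _) b1; lra.
Qed.

(** The derivative of [s^(-3/2)] at [1] is [-3/2], and the factor [e] on the
    right bounds its variation.  With [b = s^(-1/2)] and [c = t^(-1/2)], the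
    left-hand side multiplied by [b + c] is [|s - t| |P|] for a polynomial [P] in
    [b] and [c] which vanishes at [b = c = 1]. *)
Lemma invcube_taylor s t e : e <= 2^-1 -> `|s - 1| <= e -> `|t - 1| <= e ->
  `|invcube s - invcube t + 3 / 2 * (s - t)| <= 60 * e * `|s - t|.
Proof.
move=> e2 se te.
have [b [[b0 bs -> b1 bb] /andP[bl bu]]] := invsqrt_near1 e2 se.
have [c [[c0 ct -> c1 cc] /andP[cl cu]]] := invsqrt_near1 e2 te.
pose P := b ^+ 2 * c ^+ 2 * (b ^+ 2 + b * c + c ^+ 2) - 3 / 2 * (b + c).
have nb : `|b| <= 3 / 2 by rewrite gtr0_norm.
have nc : `|c| <= 3 / 2 by rewrite gtr0_norm.
have e0 : 0 <= e by rewrite (le_trans _ se).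
have hP : `|P| <= 60 * e.
  have -> : P = ((b ^+ 2 - 1) * (c * c) + (c ^+ 2 - 1)) * (b * b + b * c + c * c)
     + (b ^+ 2 - 1) + ((b - 1) * c + (c - 1)) + (c ^+ 2 - 1)
     - 3 / 2 * (b - 1) - 3 / 2 * (c - 1) by rewrite /P; field.
  have n32 : `|3 / 2 : R| <= 3 / 2 by rewrite gtr0_norm.
  have h1 := normM_le (normD_le (normM_le bb (normM_le nc nc)) cc)
    (normD_le (normD_le (normM_le nb nb) (normM_le nb nc)) (normM_le nc nc)).
  have h2 := normD_le (normM_le b1 nc) c1.
  have h3 := normM_le n32 b1; rewrite -normrN in h3.
  have h4 := normM_le n32 c1; rewrite -normrN in h4.
  have := normD_le (normD_le (normD_le (normD_le (normD_le h1 bb) h2) cc) h3) h4.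
  move/le_trans; apply; lra.
have key : (b + c) * (b ^+ 3 - c ^+ 3 + 3 / 2 * (s - t)) = - ((s - t) * P).
  have -> : (b + c) * (b ^+ 3 - c ^+ 3 + 3 / 2 * (s - t)) =
     (b ^+ 2 - c ^+ 2) * (b ^+ 2 + b * c + c ^+ 2) + 3 / 2 * (s - t) * (b + c).
    by ring.
  have -> : b ^+ 2 - c ^+ 2 = - (s - t) * (b ^+ 2 * c ^+ 2).
    have -> : - (s - t) * (b ^+ 2 * c ^+ 2) =
      b ^+ 2 * (c ^+ 2 * t) - c ^+ 2 * (b ^+ 2 * s) by ring.
    by rewrite bs ct !mulr1.
  by rewrite /P; ring.
have /= := congr1 Num.norm key; rewrite normrN !normrM.
rewrite (gtr0_norm (addr_gt0 b0 c0)) => key'.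
have bc1 : 1 <= b + c by lra.
rewrite (le_trans (ler_peMl (normr_ge0 _) bc1))// key' mulrC.
by rewrite ler_wpM2r.
Qed.
End KeplerLinearization.

HB.lock Definition kepler_modulus {R : realType} (d : nat) : R :=
  900 * d%:R ^+ 2.

Section KeplerField.
Context {R : realType} {d : nat}.
Implicit Types (x y h k xi : 'rV[R]_d) (r : R).

Definition kepler x : 'rV[R]_d := (enorm x ^+ 3)^-1 *: x.

(** The derivative at the unit vector [xi] of the Kepler field. *)
Definition kepler_lin xi h : 'rV[R]_d := h - (3 * dot h xi) *: xi.

Definition kepler_rem xi h : 'rV[R]_d :=
  kepler (xi + h) - xi - kepler_lin xi h.

Lemma kepler_linB xi h k : kepler_lin xi (h - k) = kepler_lin xi h - kepler_lin xi k.
Proof.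
apply/rowP => j; rewrite !mxE !dotE; ring.
Qed.

Lemma kepler_linZ xi a h : kepler_lin xi (a *: h) = a *: kepler_lin xi h.
Proof. by apply/rowP => j; rewrite !mxE !dotE; ring. Qed.

Lemma norm_unit_le1 xi : enorm xi = 1 -> `|xi| <= 1.
Proof. by move=> <-; exact: norm_le_enorm. Qed.

Lemma kepler_lin_bound xi h : enorm xi = 1 ->
  `|kepler_lin xi h| <= (1 + 3 * d%:R) * `|h|.
Proof.
move=> xi1; apply: (le_trans (ler_normB _ _)).
rewrite [leRHS]mulrDl mul1r lerD2l normrZ -[leRHS]mulr1.
apply: ler_pM => //; last exact: norm_unit_le1.
rewrite normrM (gtr0_norm (ltr0Sn R 2)) -mulrA ler_wpM2l//.
apply: (le_trans (dot_le_norm _ _)); rewrite ler_wpM2l//.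
by rewrite ler_piMr// norm_unit_le1.
Qed.

Lemma dot_shift xi h : enorm xi = 1 ->
  dot (xi + h) (xi + h) = 1 + 2 * dot h xi + dot h h.
Proof. by move=> xi1; rewrite !dotE -enorm_sqr xi1 (dotC xi h); ring. Qed.

Lemma dot_shift_near1 xi h r : (0 < d)%N -> enorm xi = 1 ->
  r <= (6 * d%:R)^-1 -> `|h| <= r ->
  3 * d%:R * r <= 2^-1 /\ `|dot (xi + h) (xi + h) - 1| <= 3 * d%:R * r.
Proof.
move=> d0 xi1 r6 hr.
have D1 : 1 <= d%:R :> R by rewrite ler1n.
have r0 : 0 <= r by rewrite (le_trans _ hr).
have rD : 6 * d%:R * r <= 1.
  by rewrite mulrC -ler_pdivlMr ?mul1r// mulr_gt0// (lt_le_trans ltr01).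
have r1 : r <= 1.
  by rewrite (le_trans _ rD)// ler_peMl//; lra.
split; first lra.
rewrite dot_shift// [X in `|X|](_ : _ = 2 * dot h xi + dot h h); last by ring.
have n2 : `|2 : R| <= 2 by rewrite gtr0_norm.
have h1 : `|dot h xi| <= d%:R * (r * 1).
  rewrite (le_trans (dot_le_norm _ _))// ler_wpM2l// ler_pM// norm_unit_le1//.
have h2 : `|dot h h| <= d%:R * (r * 1).
  by rewrite (le_trans (dot_le_norm _ _))// ler_wpM2l// ler_pM// (le_trans hr).
rewrite (le_trans (normD_le (normM_le n2 h1) h2))//; lra.
Qed.

Lemma kepler_rem0 xi : enorm xi = 1 -> kepler_rem xi 0 = 0.
Proof.
move=> xi1; rewrite /kepler_rem /kepler addr0 xi1 expr1n invr1 scale1r.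
by have := kepler_linB xi 0 0; rewrite !subrr => ->; rewrite !subr0.
Qed.

Lemma kepler_modulus_gt0 : (0 < d)%N -> 0 < kepler_modulus d :> R.
Proof.
move=> d0; rewrite kepler_modulus.unlock; apply: mulr_gt0; first exact: ltr0Sn.
by apply: exprn_gt0; rewrite ltr0n.
Qed.

(** The remainder of the first order expansion is quadratic, so on the ball of
    radius [r] its Lipschitz constant is proportional to [r].  It splits into
    the scalar estimate [invcube_taylor] applied to the squared norms, and
    three products of two small factors. *)
Lemma kepler_rem_lipschitz xi h k r : (0 < d)%N -> enorm xi = 1 ->
  r <= (6 * d%:R)^-1 -> `|h| <= r -> `|k| <= r ->
  `|kepler_rem xi h - kepler_rem xi k| <= kepler_modulus d * r * `|h - k|.
Proof.
move=> d0 xi1 r6 hr kr.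
have D1 : 1 <= d%:R :> R by rewrite ler1n.
have r0 : 0 <= r by rewrite (le_trans _ hr).
have [e2 Sh1] := dot_shift_near1 d0 xi1 r6 hr.
have [_ Sk1] := dot_shift_near1 d0 xi1 r6 kr.
have r1 : r <= 1 by rewrite (le_trans (_ : r <= 3 * d%:R * r))// ?ler_peMl//; lra.
have VD (a b : R) (v u : 'rV[R]_d) : `|u| <= a -> `|v| <= b -> `|u + v| <= a + b.
  by move=> ua vb; rewrite (le_trans (ler_normD _ _))// lerD.
pose Sh := dot (xi + h) (xi + h); pose Sk := dot (xi + k) (xi + k).
have hx := norm_unit_le1 xi1.
pose n := `|h - k|; have n0 : 0 <= n by exact: normr_ge0.
have c1 : `|dot (h - k) xi| <= d%:R * (n * 1).
  by rewrite (le_trans (dot_le_norm _ _))// ler_wpM2l// ler_pM.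
have c2 : `|dot (h - k) (h + k)| <= d%:R * (n * (2 * r)).
  rewrite (le_trans (dot_le_norm _ _))// ler_wpM2l// ler_pM//.
  by rewrite (le_trans (VD _ _ _ _ hr kr))//; lra.
have ShkE : Sh - Sk = 2 * dot (h - k) xi + dot (h - k) (h + k).
  by rewrite /Sh /Sk !dot_shift// !dotE (dotC k h); ring.
have n2 : `|2 : R| <= 2 by rewrite gtr0_norm.
have n32 : `|- (3 / 2) : R| <= 3 / 2 by rewrite normrN gtr0_norm.
have Shk : `|Sh - Sk| <= 4 * d%:R * n.
  rewrite ShkE (le_trans (normD_le (normM_le n2 c1) c2))//.
  have : d%:R * n * r <= d%:R * n by rewrite ler_piMr// mulr_ge0.
  lra.
have t1 := invcube_taylor e2 Sh1 Sk1; rewrite -/Sh -/Sk in t1.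
have t2 := invcube_near1 e2 Sh1; rewrite -/Sh in t2.
have E0 : 0 <= 3 * d%:R * r by rewrite (le_trans _ Sh1).
have u1 : `|invcube Sh - invcube Sk + 3 / 2 * (Sh - Sk)|
    <= 60 * (3 * d%:R * r) * (4 * d%:R * n).
  by rewrite (le_trans t1)// ler_wpM2l// mulr_ge0.
have u2 : `|invcube Sh - invcube Sk| <= 126 * d%:R * n.
  have -> : invcube Sh - invcube Sk =
    (invcube Sh - invcube Sk + 3 / 2 * (Sh - Sk)) + - (3 / 2) * (Sh - Sk) by ring.
  rewrite (le_trans (normD_le u1 (normM_le n32 Shk)))//.
  have : 0 <= (2^-1 - 3 * d%:R * r) * (d%:R * n).
    by rewrite mulr_ge0 ?subr_ge0 ?mulr_ge0.
  lra.
have -> : kepler_rem xi h - kepler_rem xi k =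
    (invcube Sh - invcube Sk + 3 / 2 * (Sh - Sk)) *: xi
    + (- (3 / 2) * dot (h - k) (h + k)) *: xi
    + (invcube Sh - 1) *: (h - k) + (invcube Sh - invcube Sk) *: k.
  apply/rowP => j; rewrite !mxE -/(invcube Sh) -/(invcube Sk).
  rewrite ShkE; move: (invcube Sh) (invcube Sk) => qh qk.
  by rewrite !dotE; field.
have Z (a b u : R) (v : 'rV[R]_d) : `|a| <= b -> `|v| <= u -> `|a *: v| <= b * u.
  by move=> ab vu; rewrite normrZ ler_pM.
have := VD _ _ _ _ (VD _ _ _ _ (VD _ _ _ _ (Z _ _ _ _ u1 hx)
   (Z _ _ _ _ (normM_le n32 c2) hx)) (Z _ _ _ _ t2 (lexx n))) (Z _ _ _ _ u2 kr).
(* The four terms add up to (720 d^2 + 3 d + 30 d + 126 d) r n. *)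
move/le_trans; apply; rewrite -/n kepler_modulus.unlock.
have : d%:R * r * n <= d%:R ^+ 2 * r * n.
  by rewrite !ler_wpM2r// expr2 ler_peMl// (le_trans ler01).
have : 0 <= d%:R ^+ 2 * r * n by rewrite !mulr_ge0// exprn_ge0.
lra.
Qed.

Lemma kepler_rem_bound xi h r : (0 < d)%N -> enorm xi = 1 ->
  r <= (6 * d%:R)^-1 -> `|h| <= r ->
  `|kepler_rem xi h| <= kepler_modulus d * r ^+ 2.
Proof.
move=> d0 xi1 r6 hr; have r0 : 0 <= r by rewrite (le_trans _ hr).
have z : `|0 : 'rV[R]_d| <= r by rewrite normr0.
have := kepler_rem_lipschitz d0 xi1 r6 hr z.
rewrite kepler_rem0// !subr0 => /le_trans; apply.
by rewrite [r ^+ 2]expr2 mulrA ler_wpM2l// mulr_ge0// ltW// kepler_modulus_gt0.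
Qed.
End KeplerField.

(** * Contractions for a weighted sup norm *)
Section WeightedContraction.
Context {R : realType} {d : nat}.
Implicit Types (v u : R -> 'rV[R]_d) (w e delta : R) (p : R -> R).

Definition weighted_ball p delta v :=
  (forall w, 0 < w -> {for w, continuous v}) /\
  (forall w, 0 < w -> `|v w| <= delta * p w).

Lemma halving_small delta e : 0 < e -> exists n, delta * 2^-1 ^+ n <= e.
Proof.
move=> e0; have : (fun n => delta * (2^-1 : R) ^+ n) @ \oo --> (delta * 0 : R).
  apply: cvgM; first exact: cvg_cst.
  by apply: cvg_expr; rewrite ger0_norm// invf_lt1// ltr1n.
rewrite mulr0 => /cvgrPdist_le/(_ _ e0)[n _ h]; exists n.
have := h n (leqnn n); rewrite /= sub0r normrN.
exact: le_trans (ler_norm _).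
Qed.

(** Banach's theorem for the distance [sup |v w - u w| / p w].  Since [p <= 1],
    convergence for this distance is uniform, and the limit of the iterates
    stays continuous. *)
Lemma weighted_contraction_fixed_point p delta
    (T : (R -> 'rV[R]_d) -> R -> 'rV[R]_d) :
  (forall w, 0 < w -> 0 <= p w <= 1) -> 0 <= delta ->
  (forall v, weighted_ball p delta v -> weighted_ball p delta (T v)) ->
  (forall v u D, weighted_ball p delta v -> weighted_ball p delta u ->
    (forall w, 0 < w -> `|v w - u w| <= D * p w) ->
    forall w, 0 < w -> `|T v w - T u w| <= D * 2^-1 * p w) ->
  exists v, weighted_ball p delta v /\ forall w, 0 < w -> T v w = v w.
Proof.
move=> p01 d0 TS TC.
pose y n := iter n T (fun=> 0).
have S0 : weighted_ball p delta (fun=> 0).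
  split=> [w _|w w0]; first exact: cvg_cst.
  by rewrite normr0 mulr_ge0//; case/andP: (p01 _ w0).
have Sy n : weighted_ball p delta (y n) by elim: n => //= n; exact: TS.
(* For n = 0 this is the size of the ball, so no geometric series is summed. *)
have yd n m w : 0 < w -> `|y (n + m)%N w - y n w| <= delta * 2^-1 ^+ n * p w.
  elim: n w => [|n ih] w w0.
    by rewrite /= subr0 expr0 mulr1; exact: (Sy m).2.
  rewrite exprSr mulrA; exact: TC.
have half_ge0 n : 0 <= delta * 2^-1 ^+ n by rewrite mulr_ge0// exprn_ge0.
have yd1 n m w : 0 < w -> `|y (n + m)%N w - y n w| <= delta * 2^-1 ^+ n.
  move=> w0; rewrite (le_trans (yd n m w w0))// ler_piMr//.
  by case/andP: (p01 _ w0).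
have yc w : 0 < w -> cvgn (fun n => y n w).
  move=> w0; apply/cauchy_cvgP/cauchy_exP => e e0.
  have [n ne] := halving_small delta (divr_gt0 e0 (ltr0Sn R 1)).
  exists (y n w); exists n => // m /= nm; rewrite -ball_normE /=.
  rewrite distrC -(subnKC nm) (le_lt_trans (yd1 _ _ _ w0))//.
  by rewrite (le_lt_trans ne)// gtr_pMr// invf_lt1// ltr1n.
pose v w := limn (fun n => y n w).
have vd n w : 0 < w -> `|v w - y n w| <= delta * 2^-1 ^+ n * p w.
  move=> w0; apply/ler_addgt0Pl => e e0.
  have /cvgrPdist_le/(_ _ e0)[m _ h] := yc _ w0.
  rewrite -(subrKA (y (n + m)%N w)) (le_trans (ler_normD _ _))//.
  by rewrite lerD ?yd//; apply: h; rewrite /= leq_addl.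
have vd1 n w : 0 < w -> `|v w - y n w| <= delta * 2^-1 ^+ n.
  move=> w0; rewrite (le_trans (vd n w w0))// ler_piMr//.
  by case/andP: (p01 _ w0).
have Sv : weighted_ball p delta v.
  split=> [w w0|w w0]; last by have := vd 0%N _ w0; rewrite /= subr0 expr0 mulr1.
  apply/cvgrPdist_le => e e0.
  have [n ne] := halving_small delta (divr_gt0 e0 (ltr0Sn R 2)).
  have /cvgrPdist_le/(_ _ (divr_gt0 e0 (ltr0Sn R 2))) := (Sy n).1 _ w0.
  move=> yn; near=> u.
  have u0 : 0 < u by near: u; exact: lt_nbhsr.
  have -> : v w - v u = (v w - y n w) + (y n w - y n u) - (v u - y n u).
    by rewrite opprB !subrKA.
  rewrite (le_trans (ler_normB _ _))//.
  rewrite (le_trans (lerD (ler_normD _ _) (lexx _)))//.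
  have h1 := vd1 n _ w0; have h2 := vd1 n _ u0.
  have h3 : `|y n w - y n u| <= e / 3 by near: u.
  by lra.
exists v; split=> // w w0; apply/eqP; rewrite -subr_eq0 -normr_le0.
apply/ler_addgt0Pl => e e0; rewrite addr0.
have [n ne] := halving_small delta (divr_gt0 e0 (ltr0Sn R 1)).
have h1 := TC _ _ _ Sv (Sy n) (vd n) w w0.
have h2 := vd1 n.+1 w w0.
have -> : T v w - v w = (T v w - T (y n) w) - (v w - y n.+1 w).
  by rewrite opprB subrKA.
rewrite (le_trans (ler_normB _ _))//.
have h3 : delta * 2^-1 ^+ n * 2^-1 * p w <= delta * 2^-1 ^+ n * 2^-1.
  by rewrite ler_piMr ?mulr_ge0//; case/andP: (p01 _ w0).
by move: h2; rewrite exprSr; lra.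
Unshelve. all: by end_near. Qed.
End WeightedContraction.

(** * The linearized equation for vectors *)
Section VectorSolver.
Context {R : realType} {d : nat}.
Implicit Types (f g : R -> 'rV[R]_d) (b c xi : 'rV[R]_d) (w K B : R).

Definition vector_source f :=
  (forall w, 0 < w -> {for w, continuous f}) /\
  (exists K, forall w, 0 < w -> `|f w| <= K).

Lemma vector_source_coord f j : vector_source f ->
  bounded_source (fun w => f w ord0 j).
Proof.
case=> fc [K fK]; split=> [w w0|].
  exact: (@cvg_comp _ _ _ f (fun u : 'rV[R]_d => u ord0 j) _ _ _ (fc _ w0)
    (@coord_continuous _ _ _ ord0 j (f w))).
by exists K => w w0; rewrite (le_trans (coord_le_norm _ _))// fK.
Qed.

Lemma vector_source_dot f xi : vector_source f ->
  bounded_source (fun w => dot (f w) xi).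
Proof.
case=> fc [K fK]; split=> [w w0|].
  by apply: (@cvg_dot _ _ _ (nbhs w) _ f (fun=> xi)); [exact: fc|exact: cvg_cst].
exists (d%:R * (K * `|xi|)) => w w0; rewrite (le_trans (dot_le_norm _ _))//.
by rewrite ler_wpM2l// ler_wpM2r// fK.
Qed.

(** [free_sol] is right for the components orthogonal to [xi]; the last term
    replaces it by [radial_sol] in the direction of [xi]. *)
Definition vector_sol xi f b w : 'rV[R]_d :=
  \row_j free_sol (fun u => f u ord0 j) (b ord0 j) w +
  (radial_sol (fun u => dot (f u) xi) (dot b xi) w
   - free_sol (fun u => dot (f u) xi) (dot b xi) w) *: xi.

Definition vector_vel xi f b w : 'rV[R]_d :=
  \row_j free_vel (fun u => f u ord0 j) (b ord0 j) w +
  (radial_vel (fun u => dot (f u) xi) (dot b xi) w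
   - free_vel (fun u => dot (f u) xi) (dot b xi) w) *: xi.

Lemma vector_sol1 xi f b : vector_sol xi f b 1 = b.
Proof.
apply/rowP => j; rewrite !mxE radial_sol1 !free_sol1; ring.
Qed.

(** [free_sol] commutes with the scalar product by [xi], being linear. *)
Lemma dot_vector_sol xi f b w : enorm xi = 1 -> vector_source f ->
  dot (vector_sol xi f b w) xi =
  radial_sol (fun u => dot (f u) xi) (dot b xi) w.
Proof.
move=> xi1 sf; rewrite /vector_sol dotDl dotZl -enorm_sqr xi1 expr1n mulr1.
suff -> : dot (\row_j free_sol (fun u => f u ord0 j) (b ord0 j) w) xi =
  free_sol (fun u => dot (f u) xi) (dot b xi) w by ring.
have af j := bounded_source_admissible (vector_source_coord j sf).
rewrite dotC [LHS](_ : _ = \sum_j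
  xi ord0 j * free_sol (fun u => f u ord0 j) (b ord0 j) w); last first.
  by apply: eq_bigr => j _; rewrite mxE.
rewrite -(free_sol_sum _ _ _ _ af) (dotC b).
congr (free_sol _ _ w); apply/funext => u; exact: dotC.
Qed.

Lemma is_derive_vector_sol xi f b w j : vector_source f -> 0 < w ->
  is_derive w 1 (fun u => vector_sol xi f b u ord0 j) (vector_vel xi f b w ord0 j).
Proof.
move=> sf w0; have sd := vector_source_dot xi sf.
have sj := vector_source_coord j sf.
have d1 := is_derive_free_sol (b ord0 j) (bounded_source_admissible sj) w0.
have d2 := is_derive_radial_sol (dot b xi) sd w0.
have d3 := is_derive_free_sol (dot b xi) (bounded_source_admissible sd) w0.
have := is_derive1D d1 (is_derive1Mr (xi ord0 j) (is_derive1B d2 d3)).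
rewrite /vector_vel !mxE; congr is_derive.
by apply/funext => u; rewrite !mxE.
Qed.

Lemma is_derive_vector_vel xi f b w j : enorm xi = 1 -> vector_source f -> 0 < w ->
  is_derive w 1 (fun u => vector_vel xi f b u ord0 j)
    ((f w + (6 * w ^- 2 * dot (vector_sol xi f b w) xi) *: xi) ord0 j).
Proof.
move=> xi1 sf w0; have sd := vector_source_dot xi sf.
have sj := vector_source_coord j sf.
have d1 := is_derive_free_vel (b ord0 j) (bounded_source_admissible sj) w0.
have d2 := is_derive_radial_vel (dot b xi) sd w0.
have d3 := is_derive_free_vel (dot b xi) (bounded_source_admissible sd) w0.
have := is_derive1D d1 (is_derive1Mr (xi ord0 j) (is_derive1B d2 d3)).
rewrite !mxE dot_vector_sol// addrK.
suff -> : (fun u => vector_vel xi f b u ord0 j) = (fun y : R =>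
   free_vel (fun u => f u ord0 j) (b ord0 j) y +
   (radial_vel (fun u => dot (f u) xi) (dot b xi) y -
    free_vel (fun u => dot (f u) xi) (dot b xi) y) * xi ord0 j) by [].
by apply/funext => u; rewrite !mxE.
Qed.

Lemma vector_sol_bound xi f b K B w : enorm xi = 1 -> vector_source f ->
  (forall u, 0 < u -> `|f u| <= K) -> `|b| <= B -> 0 < w <= 1 ->
  `|vector_sol xi f b w| <= (1 + 2 * d%:R) * (B + 2 * K) * w /\
  `|vector_vel xi f b w| <= (1 + 6 * d%:R) * (B + 2 * K).
Proof.
move=> xi1 sf fK bB w01; have sd := vector_source_dot xi sf.
have /andP[w0 w1] := w01.
have K0 : 0 <= K by rewrite (le_trans _ (fK 1 _)).
have B0 : 0 <= B by rewrite (le_trans _ bB).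
have hx := norm_unit_le1 xi1.
have gK u : 0 < u -> `|dot (f u) xi| <= d%:R * K.
  move=> u0; rewrite (le_trans (dot_le_norm _ _))// ler_wpM2l//.
  by rewrite -[leRHS]mulr1 ler_pM// fK.
have aB : `|dot b xi| <= d%:R * B.
  rewrite (le_trans (dot_le_norm _ _))// ler_wpM2l//.
  by rewrite -[leRHS]mulr1 ler_pM.
have gK1 u : 0 < u <= 1 -> `|dot (f u) xi| <= d%:R * K.
  by case/andP => u0 _; exact: gK.
have [rs rv] := radial_sol_bound sd gK aB w01.
have [fs fv] := free_sol_bound (bounded_source_admissible sd) gK1 aB w01.
have F j : `|free_sol (fun u => f u ord0 j) (b ord0 j) w| <= (B + 2 * K) * w /\
    `|free_vel (fun u => f u ord0 j) (b ord0 j) w| <= B + 2 * K.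
  apply: free_sol_bound => //.
  - exact: bounded_source_admissible (vector_source_coord j sf).
  - by move=> u /andP[u0 _]; rewrite (le_trans (coord_le_norm _ _))// fK.
  - by rewrite (le_trans (coord_le_norm _ _)).
have BK0 : 0 <= B + 2 * K by rewrite addr_ge0// mulr_ge0.
have S (r s : R) t : `|r| <= t -> `|s| <= t -> `|(r - s) *: xi| <= 2 * t.
  move=> rt st; rewrite normrZ -[leRHS]mulr1 ler_pM//.
  by rewrite (le_trans (ler_normB _ _))//; lra.
split; rewrite (le_trans (ler_normD _ _))//.
  have h1 : `|\row_j free_sol (fun u => f u ord0 j) (b ord0 j) w| <= (B + 2 * K) * w.
    apply: norm_le_coord; first by rewrite mulr_ge0// ltW.
    by move=> j; rewrite mxE; case: (F j).
  by have h2 := S _ _ _ rs fs; lra.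
have h1 : `|\row_j free_vel (fun u => f u ord0 j) (b ord0 j) w| <= B + 2 * K.
  by apply: norm_le_coord => // j; rewrite mxE; case: (F j).
have dB0 : 0 <= d%:R * B by rewrite mulr_ge0.
have dK0 : 0 <= d%:R * K by rewrite mulr_ge0.
have fv' : `|free_vel (fun u => dot (f u) xi) (dot b xi) w| <=
  3 * (d%:R * B) + 4 * (d%:R * K) by lra.
have h2 := S _ _ _ rv fv'; lra.
Qed.

Lemma vector_solB xi f g b w : vector_source f -> vector_source g ->
  vector_sol xi f b w - vector_sol xi g b w =
  vector_sol xi (fun u => f u - g u) 0 w.
Proof.
move=> sf sg; have df := vector_source_dot xi sf; have dg := vector_source_dot xi sg.
have FS (h k : R -> R) (a : R) : admissible h -> admissible k ->
    free_sol (fun u => h u - k u) 0 w = free_sol h a w - free_sol k a w.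
  move=> ah ak; rewrite [RHS]addrC -mulN1r.
  rewrite -(free_sol_linear (-1) a a w ak ah); congr (free_sol _ _ w).
    by apply/funext => u; ring.
  by ring.
have RS : radial_sol (fun u => dot (f u) xi - dot (g u) xi) 0 w =
    radial_sol (fun u => dot (f u) xi) (dot b xi) w
    - radial_sol (fun u => dot (g u) xi) (dot b xi) w.
  rewrite [RHS]addrC -mulN1r.
  rewrite -(radial_sol_linear (-1) (dot b xi) (dot b xi) w dg df); congr (radial_sol _ _ w).
    by apply/funext => u; ring.
  by ring.
have dz : dot (0 : 'rV[R]_d) xi = 0 by rewrite -(scale0r xi) dotZl mul0r.
have dfg : (fun u => dot (f u - g u) xi) = (fun u => dot (f u) xi - dot (g u) xi).
  by apply/funext => u; rewrite dotDl dotNl.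
apply/rowP => j; rewrite /vector_sol dfg dz !mxE.
have -> : (fun u => (f u - g u) ord0 j) = (fun u => f u ord0 j - g u ord0 j).
  by apply/funext => u; rewrite !mxE.
rewrite RS (FS _ _ (dot b xi)); [|exact: bounded_source_admissible..].
rewrite (FS _ _ (b ord0 j)); last first.
- exact: bounded_source_admissible (vector_source_coord j sg).
- exact: bounded_source_admissible (vector_source_coord j sf).
by ring.
Qed.
End VectorSolver.

(** * The nonlinear source term *)
Section ReducedProblem.
Context {R : realType} {d N : nat}.
Implicit Types (v u : R -> 'rV[R]_d) (b c xi h k : 'rV[R]_d) (w K B e r q delta : R).

(** Freezing data at [w = 1] makes every source bounded on the half-line. *)
Definition clamp w : R := Num.min w 1.

Lemma clamp_itv w : 0 < w -> 0 < clamp w <= 1.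
Proof. by move=> w0; rewrite lt_min w0 ltr01 ge_min lexx orbT. Qed.

Lemma clamp_id w : w <= 1 -> clamp w = w.
Proof. by move=> w1; rewrite /clamp min_l. Qed.

Lemma clamp_continuous : continuous clamp.
Proof.
by move=> w; apply: continuous_min; [exact: cvg_id|exact: cvg_cst].
Qed.

(** One centre's contribution to the source of the linearized equation: [h] is
    the displacement from [xi], [c] the rescaled centre.  The linear part in [c]
    is taken out of the remainder, where it has exactly the factor [q^2] that
    cancels the singular coefficient [2 / q^2]. *)
Definition source_term xi q h c : 'rV[R]_d :=
  2 *: kepler_lin xi c - (2 / q ^+ 2) *: kepler_rem xi (h - q ^+ 2 *: c).

Lemma source_termE xi q h c : q != 0 ->
  q ^+ 2 *: source_term xi q h c =
  2 *: (xi + kepler_lin xi h - kepler (xi + (h - q ^+ 2 *: c))).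
Proof.
move=> q0; rewrite /source_term /kepler_rem kepler_linB kepler_linZ.
move: (kepler _) (kepler_lin xi h) (kepler_lin xi c) => y lh lc.
by apply/rowP => j; rewrite !mxE; field.
Qed.

Lemma displacement_bound q h c delta e : 0 < q <= 1 -> `|h| <= delta * q ->
  `|c| <= e -> e <= delta -> `|h - q ^+ 2 *: c| <= 2 * delta * q.
Proof.
move=> /andP[q0 q1] hd ce ed; rewrite (le_trans (ler_normB _ _))//.
have : `|q ^+ 2 *: c| <= q * delta.
  rewrite normrZ ger0_norm ?exprn_ge0 ?(ltW q0)// expr2 -mulrA.
  rewrite ler_wpM2l ?(ltW q0)// -[leRHS]mul1r ler_pM ?(ltW q0)//.
  exact: le_trans ed.
by lra.
Qed.

(** The displacement is [O(delta q)], so the quadratic remainder absorbs the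
    factor [2 / q^2]. *)
Lemma source_term_bound xi q h c delta e : (0 < d)%N -> enorm xi = 1 ->
  0 < q <= 1 -> `|h| <= delta * q -> `|c| <= e -> e <= delta ->
  2 * delta <= (6 * d%:R)^-1 ->
  `|source_term xi q h c| <=
    2 * (1 + 3 * d%:R) * e + 8 * kepler_modulus d * delta ^+ 2.
Proof.
move=> dgt0 xi1 q01 hd ce ed dsmall.
have /andP[q0 q1] := q01.
have disp := displacement_bound q01 hd ce ed.
have d0 : 0 <= delta by rewrite (le_trans _ ed)// (le_trans _ ce).
have small : 2 * delta * q <= (6 * d%:R)^-1.
  by rewrite (le_trans _ dsmall)// ler_piMr// mulr_ge0.
have rb := kepler_rem_bound dgt0 xi1 small disp.
have qN0 : q != 0 by rewrite gt_eqF.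
have q2 : 0 < 2 / q ^+ 2 by rewrite divr_gt0// exprn_gt0.
apply: (le_trans (ler_normB _ _)); apply: lerD.
  rewrite normrZ (gtr0_norm (ltr0Sn R 1)) -mulrA; apply: ler_wpM2l => //.
  apply: (le_trans (kepler_lin_bound _ xi1)); apply: ler_wpM2l => //.
rewrite normrZ (gtr0_norm q2).
rewrite (_ : 8 * _ * _ = 2 / q ^+ 2 * (kepler_modulus d * (2 * delta * q) ^+ 2)).
  by rewrite ler_wpM2l// ltW.
by field.
Qed.

Lemma source_term_lipschitz xi q h k c delta e D : (0 < d)%N -> enorm xi = 1 ->
  0 < q <= 1 -> `|h| <= delta * q -> `|k| <= delta * q -> `|c| <= e ->
  e <= delta -> 2 * delta <= (6 * d%:R)^-1 -> `|h - k| <= D * q ->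
  `|source_term xi q h c - source_term xi q k c| <=
    4 * kepler_modulus d * delta * D.
Proof.
move=> dgt0 xi1 q01 hd kd ce ed dsmall hkD.
have /andP[q0 q1] := q01.
have disph := displacement_bound q01 hd ce ed.
have dispk := displacement_bound q01 kd ce ed.
have d0 : 0 <= delta by rewrite (le_trans _ ed)// (le_trans _ ce).
have small : 2 * delta * q <= (6 * d%:R)^-1.
  by rewrite (le_trans _ dsmall)// ler_piMr// mulr_ge0.
have := kepler_rem_lipschitz dgt0 xi1 small disph dispk.
rewrite [X in _ * `|X|](_ : _ = h - k); last first.
  by apply/rowP => j; rewrite !mxE; ring.
move=> rl.
rewrite [X in `|X|](_ : _ = - (2 / q ^+ 2) *:
  (kepler_rem xi (h - q ^+ 2 *: c) - kepler_rem xi (k - q ^+ 2 *: c))); last first.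
  by apply/rowP => j; rewrite !mxE; ring.
have qN0 : q != 0 by rewrite gt_eqF.
have q2 : 0 < 2 / q ^+ 2 by rewrite divr_gt0// exprn_gt0.
rewrite normrZ normrN (gtr0_norm q2).
have C0 := ltW (@kepler_modulus_gt0 R d dgt0).
have h1 : kepler_modulus d * (2 * delta * q) * `|h - k| <=
    kepler_modulus d * (2 * delta * q) * (D * q).
  by rewrite ler_wpM2l// mulr_ge0// mulr_ge0 ?mulr_ge0 ?(ltW q0).
rewrite (_ : 4 * _ * _ * _ =
    2 / q ^+ 2 * (kepler_modulus d * (2 * delta * q) * (D * q))).
  by rewrite ler_wpM2l ?(ltW q2)// (le_trans rl).
by field.
Qed.

Lemma cvg_kepler (T : Type) (F : set_system T) {FF : Filter F}
    (f : T -> 'rV[R]_d) h : 0 < dot h h ->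
  f t @[t --> F] --> h -> kepler (f t) @[t --> F] --> kepler h.
Proof.
move=> h0 fh; apply: cvgZ => //; apply: cvgV.
  by rewrite expf_neq0// gt_eqF// sqrtr_gt0.
have cn := @cvg_comp _ _ _ f (@enorm R d) _ _ _ fh (@enorm_continuous R d h).
exact: (@cvg_comp _ _ _ (@enorm R d \o f) (fun z => z ^+ 3) _ _ _ cn
  (@exprn_continuous R 3 (enorm h))).
Qed.

Lemma cvg_kepler_lin (T : Type) (F : set_system T) {FF : Filter F}
    (f : T -> 'rV[R]_d) xi h :
  f t @[t --> F] --> h -> kepler_lin xi (f t) @[t --> F] --> kepler_lin xi h.
Proof.
move=> fh; apply: cvgB => //; apply: cvgZ; last exact: cvg_cst.
by apply: cvgM; [exact: cvg_cst|apply: cvg_dot => //; exact: cvg_cst].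
Qed.

Lemma continuous_source_term xi v (c : R -> 'rV[R]_d) w : 0 < w ->
  {for w, continuous v} -> {for w, continuous c} ->
  0 < dot (xi + (v w - clamp w ^+ 2 *: c w)) (xi + (v w - clamp w ^+ 2 *: c w)) ->
  {for w, continuous (fun z => source_term xi (clamp z) (v z) (c z))}.
Proof.
move=> w0 vc cc h0.
have q2 : (clamp z ^+ 2) @[z --> w] --> clamp w ^+ 2.
  exact: (@cvg_comp _ _ _ clamp (fun z => z ^+ 2) _ _ _ (@clamp_continuous w)
  (@exprn_continuous R 2 (clamp w))).
have disp : (v z - clamp z ^+ 2 *: c z) @[z --> w] --> v w - clamp w ^+ 2 *: c w.
  by apply: cvgB => //; exact: cvgZ.
have /andP[q0 _] := clamp_itv w0.
apply: cvgB.
  by apply: cvgZ; [exact: cvg_cst|exact: cvg_kepler_lin].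
apply: cvgZ.
  by apply: cvgM; [exact: cvg_cst|apply: cvgV => //; rewrite expf_neq0// gt_eqF].
apply: cvgB; last exact: cvg_kepler_lin.
apply: cvgB; last exact: cvg_cst.
apply: cvg_kepler => //.
by apply: cvgD => //; exact: cvg_cst.
Qed.

Lemma norm_convex_sum (mu : 'I_N -> R) (g : 'I_N -> 'rV[R]_d) K :
  (forall i, 0 <= mu i) -> \sum_i mu i = 1 -> (forall i, `|g i| <= K) ->
  `|\sum_i mu i *: g i| <= K.
Proof.
move=> mu0 mu1 gK; rewrite (le_trans (ler_norm_sum _ _ _))//.
rewrite -[leRHS]mul1r -mu1 mulr_suml ler_sum// => i _.
by rewrite normrZ ger0_norm// ler_wpM2l.
Qed.
End ReducedProblem.

(** * The reduced boundary value problem *)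
Section ReducedTheorem.
Context {R : realType} {d N : nat}.

(** The map [T] sends [v] to the solution of the linearized equation whose source
    is computed from [v].  The linear solver costs a factor [1 + 2 d], the
    source is [O(e + delta^2)] and its Lipschitz constant is [O(delta)]; for
    [delta] small, then [e] and [b] small compared to [delta], [T] is a
    contraction of the ball of radius [delta] for the weight [clamp]. *)
Lemma reduced_problem (mu : 'I_N -> R) (xi b : 'rV[R]_d)
    (c : 'I_N -> R -> 'rV[R]_d) (delta e : R) :
  (0 < d)%N -> enorm xi = 1 ->
  (forall i, 0 <= mu i) -> \sum_i mu i = 1 ->
  (forall i (w : R), 0 < w -> {for w, continuous (c i)}) ->
  (forall i (w : R), 0 < w -> `|c i w| <= e) -> 0 <= e <= delta ->
  2 * delta <= (6 * d%:R)^-1 ->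
  32 * (1 + 2 * d%:R) * kepler_modulus d * delta <= 1 ->
  16 * (1 + 2 * d%:R) * (1 + 3 * d%:R) * e <= delta ->
  4 * (1 + 2 * d%:R) * `|b| <= delta ->
  exists v v1 v2 : R -> 'rV[R]_d,
    [/\ v 1 = b,
      forall (w : R) j, 0 < w ->
        is_derive w 1 (fun u => v u ord0 j) (v1 w ord0 j) /\
        is_derive w 1 (fun u => v1 u ord0 j) (v2 w ord0 j),
      forall w : R, 0 < w -> {for w, continuous v2},
      exists K, forall w : R, 0 < w <= 1 -> `|v1 w| <= K &
      forall w : R, 0 < w <= 1 ->
        [/\ `|v w| <= delta * w,
          forall i, 0 < dot (xi + (v w - w ^+ 2 *: c i w))
                            (xi + (v w - w ^+ 2 *: c i w)) &
          w ^+ 2 *: v2 w = 2 *: (xi + v w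
            - \sum_i mu i *: kepler (xi + (v w - w ^+ 2 *: c i w)))]].
Proof.
move=> d0 xi1 mu0 mu1 cc ce /andP[e0 ed] dsmall dC dM dB.
have delta0 : 0 <= delta by exact: le_trans ed.
pose L : R := 1 + 2 * d%:R; have L1 : 1 <= L by rewrite lerDl mulr_ge0.
have L0 : 0 <= L by rewrite (le_trans ler01).
pose C : R := kepler_modulus d.
have C0 : 0 <= C by rewrite ltW// kepler_modulus_gt0.
pose K := 2 * (1 + 3 * d%:R) * e + 8 * C * delta ^+ 2.
pose src (v : R -> 'rV[R]_d) (w : R) :=
  \sum_i mu i *: source_term xi (clamp w) (v w) (c i w).
pose S := weighted_ball (d := d) clamp delta.
have src_bound v w : S v -> 0 < w -> `|src v w| <= K.
  move=> [_ vb] w0; apply: norm_convex_sum => // i.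
  by apply: source_term_bound; rewrite ?clamp_itv ?vb ?ce.
have disp v i w : S v -> 0 < w -> 0 < dot
    (xi + (v w - clamp w ^+ 2 *: c i w)) (xi + (v w - clamp w ^+ 2 *: c i w)).
  move=> [_ vb] w0; have q01 := clamp_itv w0; have /andP[q0 q1] := q01.
  have hd := displacement_bound q01 (vb _ w0) (ce i _ w0) ed.
  have small : 2 * delta * clamp w <= (6 * d%:R)^-1.
    by rewrite (le_trans _ dsmall)// ler_piMr// mulr_ge0.
  have [h1 h2] := dot_shift_near1 d0 xi1 small hd.
  by have := le_trans h2 h1; rewrite ler_norml => /andP[]; lra.
have src_src v : S v -> vector_source (src v).
  move=> Sv; split; last by exists K => w; exact: src_bound.
  move=> w w0; apply: (@cvg_big 'rV[R]_d 'I_N +%R 0 xpredT add_continuous R (nbhs w) _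
   (fun i z => mu i *: source_term xi (clamp z) (v z) (c i z))
   (fun i => mu i *: source_term xi (clamp w) (v w) (c i w))) => i _.
  apply: cvgZ; first exact: cvg_cst.
  by apply: continuous_source_term => //; [exact: Sv.1|exact: cc|exact: disp].
pose T v (w : R) := vector_sol xi (src v) b (clamp w).
have LK : L * (`|b| + 2 * K) <= delta.
  have : L * C * delta * delta <= 32^-1 * delta.
    by rewrite ler_wpM2r//; rewrite -/L -/C in dC; lra.
  by rewrite /K; rewrite -/L in dM dB; lra.
have TS v : S v -> S (T v).
  move=> Sv; split=> [w w0|w w0].
    have /andP[q0 _] := clamp_itv w0.
    apply: cvg_rV => j.
    apply: (@cvg_comp _ _ _ clamp (fun z => vector_sol xi (src v) b z ord0 j) _
      (nbhs (clamp w)) _ (@clamp_continuous R w)).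
    exact: is_derive_continuous (is_derive_vector_sol _ _ _ (src_src _ Sv) q0).
  have [q0 _] := andP (clamp_itv w0).
  have [h _] := vector_sol_bound xi1 (src_src _ Sv)
    (fun u u0 => src_bound v u Sv u0) (lexx `|b|) (clamp_itv w0).
  by rewrite (le_trans h)// ler_wpM2r// ltW.
have TC v u D : S v -> S u -> (forall w, 0 < w -> `|v w - u w| <= D * clamp w) ->
    forall w, 0 < w -> `|T v w - T u w| <= D * 2^-1 * clamp w.
  move=> Sv Su vuD w w0; have sv := src_src _ Sv; have su := src_src _ Su.
  rewrite /T vector_solB//.
  have D0 : 0 <= D.
    have := le_trans (normr_ge0 _) (vuD 1 ltr01).
    by rewrite clamp_id// mulr1.
  have bnd z : 0 < z -> `|src v z - src u z| <= 4 * C * delta * D.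
    move=> z0; rewrite /src -sumrB.
    under eq_bigr do rewrite -scalerBr.
    apply: norm_convex_sum => // i.
    exact: (source_term_lipschitz d0 xi1 (clamp_itv z0) (Sv.2 _ z0) (Su.2 _ z0)
      (ce i _ z0) ed dsmall (vuD _ z0)).
  have sdiff : vector_source (fun z => src v z - src u z).
    split; last by exists (4 * C * delta * D).
    by move=> z z0; apply: cvgB; [exact: sv.1|exact: su.1].
  have z0 : `|0 : 'rV[R]_d| <= 0 by rewrite normr0.
  have [h _] := vector_sol_bound xi1 sdiff bnd z0 (clamp_itv w0).
  have [q0 _] := andP (clamp_itv w0).
  rewrite (le_trans h)// ler_wpM2r ?(ltW q0)// add0r -/L.
  have : L * C * delta * D <= 32^-1 * D.
    by rewrite ler_wpM2r//; rewrite -/L -/C in dC; lra.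
  lra.
have c01 (w : R) : 0 < w -> 0 <= clamp w <= 1.
  by move=> w0; have /andP[/ltW -> ->] := clamp_itv w0.
have [u [Su Tu]] := weighted_contraction_fixed_point c01 delta0 TS TC.
have su := src_src _ Su.
have uE w : 0 < w <= 1 -> vector_sol xi (src u) b w = u w.
  by move=> /andP[w0 w1]; rewrite -(Tu _ w0) /T clamp_id.
exists (vector_sol xi (src u) b), (vector_vel xi (src u) b),
  (fun w => src u w +
    (6 * w ^- 2 * dot (vector_sol xi (src u) b w) xi) *: xi); split.
- exact: vector_sol1.
- move=> w j w0; split; first exact: is_derive_vector_sol.
  exact: is_derive_vector_vel.
- move=> w w0; apply: cvgD; first exact: su.1.
  apply: cvgZ; last exact: cvg_cst.
  apply: cvgM.
    apply: cvgM; first exact: cvg_cst.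
    by apply: cvgV; [rewrite expf_neq0// gt_eqF|exact: exprn_continuous].
  apply: cvg_dot; last exact: cvg_cst.
  apply: cvg_rV => j.
  exact: is_derive_continuous (is_derive_vector_sol _ _ _ su w0).
- exists ((1 + 6 * d%:R) * (`|b| + 2 * K)) => w w01.
  by have [] := vector_sol_bound xi1 su
    (fun u' u0 => src_bound u u' Su u0) (lexx `|b|) w01.
- move=> w w01; have /andP[w0 w1] := w01; rewrite uE//; split.
  + by have := Su.2 _ w0; rewrite clamp_id.
  + by move=> i; have := disp u i w Su w0; rewrite clamp_id.
  + rewrite scalerDr /src clamp_id// scaler_sumr.
    have wN0 : w != 0 by rewrite gt_eqF.
    under eq_bigr do rewrite scalerA mulrC -scalerA source_termE//.
    have -> : \sum_i mu i *: (2 *: (xi + kepler_lin xi (u w)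
        - kepler (xi + (u w - w ^+ 2 *: c i w)))) =
      2 *: (xi + kepler_lin xi (u w)
        - \sum_i mu i *: kepler (xi + (u w - w ^+ 2 *: c i w))).
      rewrite -[X in _ = 2 *: (X - _)]scale1r -mu1 scaler_suml -sumrB scaler_sumr.
      by apply: eq_bigr => i _; rewrite -scalerBr !scalerA mulrC.
    apply/rowP => j; rewrite !mxE; field.
    by rewrite wN0.
Qed.
End ReducedTheorem.

(** * The change of time *)
Section TimeChange.
Context {R : realType}.
Implicit Types (T t e : R).

(** The variable [w], for which [w^-2] is proportional to the homothetic
    parabolic motion [(t + T)^(2/3)]. *)
Definition shrink T t : R := (1 + t / T) `^ (- 3^-1).

Lemma shrink_base_gt0 T t : 0 < T -> 0 <= t -> 0 < 1 + t / T.
Proof. by move=> T0 t0; rewrite ltr_pwDl// divr_ge0// ltW. Qed.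

Lemma shrink_gt0 T t : 0 < T -> 0 <= t -> 0 < shrink T t.
Proof. by move=> T0 t0; rewrite powR_gt0// shrink_base_gt0. Qed.

Lemma shrinkXn T t n : 0 < T -> 0 <= t ->
  shrink T t ^+ n = (1 + t / T) `^ (- 3^-1 * n%:R).
Proof. by move=> T0 t0; rewrite powRrM powR_mulrn// powR_ge0. Qed.

Lemma shrink_cube T t : 0 < T -> 0 <= t -> shrink T t ^+ 3 = (1 + t / T)^-1.
Proof.
move=> T0 t0; rewrite shrinkXn// mulNr mulVf// powR_inv1//.
by rewrite ltW// shrink_base_gt0.
Qed.

Lemma shrink0 T : shrink T 0 = 1.
Proof. by rewrite /shrink mul0r addr0 powR1. Qed.

Lemma shrink_le1 T t : 0 < T -> 0 <= t -> shrink T t <= 1.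
Proof.
move=> T0 t0; rewrite -(@ler_pXn2r _ 3)// ?nnegrE ?(ltW (shrink_gt0 _ _))//.
rewrite expr1n shrink_cube// invf_le1 ?shrink_base_gt0//.
by rewrite lerDl divr_ge0// ltW.
Qed.

Lemma shrink_timeK T t : 0 < T -> 0 <= t -> T * (shrink T t ^- 3 - 1) = t.
Proof.
move=> T0 t0; rewrite shrink_cube// invrK addrAC subrr add0r mulrCA mulfV ?mulr1//.
by rewrite gt_eqF.
Qed.

Lemma is_derive_shrink T t : 0 < T -> 0 <= t ->
  is_derive t 1 (shrink T) (- (3 * T)^-1 * shrink T t ^+ 4).
Proof.
move=> T0 t0; have s0 := shrink_base_gt0 T0 t0.
have d1 : is_derive t 1 (fun u => 1 + u / T) (0 + 1 / T).
  exact: (is_derive1D (is_derive_cst (1 : R) t (1 : R))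
    (is_derive1Mr T^-1 (is_derive_id t (1 : R)))).
have d2 := is_derive1_powR (- 3^-1) s0.
have d3 := @is_derive1_comp _ (fun z : R => z `^ (- 3^-1)) (fun u => 1 + u / T) t _ _ d2 d1.
rewrite [shrink T](_ : _ = (fun z : R => z `^ (- 3^-1)) \o (fun u => 1 + u / T))//.
apply: (is_derive1_congr d3).
rewrite shrinkXn//.
have -> : - 3^-1 * 4 = - 3^-1 - 1 :> R by field.
by field; rewrite gt_eqF.
Qed.

Lemma shrink_cvg0 T : 0 < T -> shrink T t @[t --> +oo] --> 0.
Proof.
move=> T0; apply/cvgrPdist_le => e e0; near=> t.
have t0 : 0 <= t by near: t; apply: nbhs_pinfty_ge; rewrite num_real.
have te : T / e ^+ 3 <= t by near: t; apply: nbhs_pinfty_ge; rewrite num_real.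
rewrite sub0r normrN ger0_norm ?(ltW (shrink_gt0 _ _))//.
rewrite -(@ler_pXn2r _ 3)// ?nnegrE ?(ltW (shrink_gt0 _ _)) ?(ltW e0)//.
rewrite shrink_cube// -[leRHS]invrK lef_pV2 ?posrE ?shrink_base_gt0//; last first.
  by rewrite invr_gt0 exprn_gt0.
by rewrite ler_wpDl// ler_pdivlMr// mulrC.
Unshelve. all: by end_near. Qed.

(** The relation [r^3 = M T^2] is what makes [r (1 + t / T)^(2/3)] equal to
    [M^(1/3) (t + T)^(2/3)]; the shift by [T] is negligible at infinity. *)
Lemma shrink_asymp T r M : 0 < T -> 0 < r -> 0 < M -> r ^+ 3 = M * T ^+ 2 ->
  r * shrink T t ^- 2 / (M `^ (1 / 3) * t `^ (2 / 3)) @[t --> +oo] --> (1 : R).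
Proof.
move=> T0 r0 M0 rM.
have rE : r = M `^ (1 / 3) * T `^ (2 / 3).
  have -> : T `^ (2 / 3) = (T ^+ 2) `^ (1 / 3).
    by rewrite -powR_mulrn ?(ltW T0)// -powRrM; congr (_ `^ _); field.
  rewrite -powRM ?(ltW M0) ?sqr_ge0// -rM -powR_mulrn ?(ltW r0)// -powRrM.
  by rewrite mul1r mulfV// powRr1// ltW.
apply/cvgrPdist_le => e e0; near=> t.
have t0 : 0 < t by near: t; apply: nbhs_pinfty_gt; rewrite num_real.
have te : T / e <= t by near: t; apply: nbhs_pinfty_ge; rewrite num_real.
have s0 := shrink_base_gt0 T0 (ltW t0).
have Tt0 : 0 <= T / t by rewrite divr_ge0// ltW.
have T3 : 0 < T `^ (2 / 3) by rewrite powR_gt0.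
have M3 : 0 < M `^ (1 / 3) by rewrite powR_gt0.
have t3 : 0 < t `^ (2 / 3) by rewrite powR_gt0.
have -> : r * shrink T t ^- 2 / (M `^ (1 / 3) * t `^ (2 / 3)) =
    (1 + T / t) `^ (2 / 3).
  rewrite shrinkXn ?(ltW t0)// -powRN -mulNr opprK (_ : 3^-1 * 2 = 2 / 3); last by field.
  have -> : 1 + T / t = T * (1 + t / T) / t by field; rewrite !gt_eqF.
  rewrite powRM ?mulr_ge0 ?invr_ge0 ?(ltW T0) ?(ltW s0) ?(ltW t0)//.
  rewrite powRM ?(ltW T0) ?(ltW s0)//.
  rewrite -[t^-1]powR_inv1 ?(ltW t0)// powRAC powR_inv1 ?powR_ge0// rE.
  by field; rewrite !gt_eqF.
have y1 : 1 <= (1 + T / t) `^ (2 / 3).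
  by rewrite -[leLHS](powRr0 (1 + T / t)) ler_powR ?lerDl// divr_ge0.
have y2 : (1 + T / t) `^ (2 / 3) <= 1 + T / t.
  rewrite -[leRHS]powRr1 ?addr_ge0// ler_powR ?lerDl//; lra.
have : T / t <= e by rewrite ler_pdivrMr// mulrC -ler_pdivrMr.
by rewrite distrC ger0_norm ?subr_ge0//; lra.
Unshelve. all: by end_near. Qed.
End TimeChange.

(** * Derivatives on the half-line and homogeneity of the force *)
Section BackToTime.
Context {R : realType} {d N : nat}.
Implicit Types (x y : R -> 'rV[R]_d) (xi : 'rV[R]_d) (t w e : R).

Lemma is_derive_slope (f : R -> R) t (l : R) : is_derive t 1 f l ->
  (s - t)^-1 * (f s - f t) @[s --> t^'] --> l.
Proof.
move=> [/cvg_ex[/= k fk] fE].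
have {}fk : h^-1 *: (f (h *: 1 + t) - f t) @[h --> 0^'] --> l.
  suff <- : k = l by exact: fk.
  by rewrite -fE; apply/esym/cvg_lim.
have sub : (s - t) @[s --> t^'] --> (0 : R)^'.
  rewrite -(subrr t); apply: continuous_injective_withinNx.
    by apply: cvgB; [exact: cvg_id|exact: cvg_cst].
  by move=> s /addIr.
have := @cvg_comp _ _ _ (fun s => s - t)
  (fun h => h^-1 *: (f (h *: 1 + t) - f t)) _ _ _ sub fk; apply: cvg_trans.
apply: near_eq_cvg; near=> s; rewrite /= [_ *: 1]mulr1 subrK.
by [].
Unshelve. all: by end_near. Qed.

Lemma has_derivative_halfline_coord x y :
  (forall t j, 0 <= t -> is_derive t 1 (fun s => x s ord0 j) (y t ord0 j)) ->
  has_derivative_halfline x y.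
Proof.
move=> xy t t0; apply: cvg_rV => j.
apply: cvg_within_filter.
have := is_derive_slope (xy t j t0); apply: cvg_trans.
by apply: near_eq_cvg; near=> s; rewrite !mxE.
Unshelve. all: by end_near. Qed.

Lemma kepler_force_scale (m : 'I_N -> R) (c : 'I_N -> R -> 'rV[R]_d) t a
    (z : 'I_N -> 'rV[R]_d) (x : 'rV[R]_d) : 0 < a ->
  (forall i, x - c i t = a *: z i) ->
  force m c t x = - (a ^- 2 *: \sum_i m i *: kepler (z i)).
Proof.
move=> a0 xz; rewrite /force; congr (- _); rewrite scaler_sumr.
apply: eq_bigr => i _; rewrite xz enormZ (gtr0_norm a0) /kepler !scalerA.
congr (_ *: _); rewrite exprMn invfM.
move: (enorm (z i) ^+ 3)^-1 => n; field.
by rewrite gt_eqF.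
Qed.
End BackToTime.

(** * From the profile to the parabolic solution *)
Section ParabolicSolution.
Context {R : realType} {d N : nat}.
Implicit Types (xi : 'rV[R]_d) (t w e r T : R).

Variables (m : 'I_N -> R) (c : 'I_N -> R -> 'rV[R]_d) (xi : 'rV[R]_d).
Variables (r T delta K : R) (v v1 v2 : R -> 'rV[R]_d).
Hypothesis xi1 : enorm xi = 1.
Hypotheses (r_gt0 : 0 < r) (T_gt0 : 0 < T).
Let M := \sum_i m i.
Hypothesis M_gt0 : 0 < M.
Hypothesis rTM : r ^+ 3 = 9 / 2 * M * T ^+ 2.
Let centre i w := r^-1 *: c i (T * (clamp w ^- 3 - 1)).
Let z i w := xi + (v w - w ^+ 2 *: centre i w).
Hypothesis v_derive : forall w j, 0 < w ->
  is_derive w 1 (fun u => v u ord0 j) (v1 w ord0 j) /\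
  is_derive w 1 (fun u => v1 u ord0 j) (v2 w ord0 j).
Hypothesis v2_continuous : forall w, 0 < w -> {for w, continuous v2}.
Hypothesis v1_bound : forall w, 0 < w <= 1 -> `|v1 w| <= K.
Hypothesis v_bound : forall w, 0 < w <= 1 -> `|v w| <= delta * w.
Hypothesis z_neq0 : forall i w, 0 < w <= 1 -> 0 < dot (z i w) (z i w).
Hypothesis v_ode : forall w, 0 < w <= 1 ->
  w ^+ 2 *: v2 w = 2 *: (xi + v w - \sum_i (m i / M) *: kepler (z i w)).

Let W := shrink T.
(** Position, velocity and acceleration; [dW/dt = - W^4 / (3 T)]. *)
Let X t := (r * W t ^- 2) *: (xi + v (W t)).
Let X1 t := (- (r / (3 * T))) *: (W t ^+ 2 *: v1 (W t) - (2 * W t) *: (xi + v (W t))).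
Let X2 t := (r / (9 * T ^+ 2) * W t ^+ 4) *:
  (W t ^+ 2 *: v2 (W t) - 2 *: (xi + v (W t))).

Let W_itv t : 0 <= t -> 0 < W t <= 1.
Proof. by move=> t0; rewrite shrink_gt0// shrink_le1. Qed.

Let W_continuous t : 0 <= t -> {for t, continuous W}.
Proof. by move=> t0; exact: is_derive_continuous (is_derive_shrink T_gt0 t0). Qed.

Let is_derive_comp_W (f : R -> R) t (a : R) : 0 <= t -> is_derive (W t) 1 f a ->
  is_derive t 1 (fun s => f (W s)) (a * (- (3 * T)^-1 * W t ^+ 4)).
Proof.
move=> t0 fa.
exact: (@is_derive1_comp _ f W t _ _ fa (is_derive_shrink T_gt0 t0)).
Qed.

Let X_derive t j : 0 <= t ->
  is_derive t 1 (fun s => X s ord0 j) (X1 t ord0 j).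
Proof.
move=> t0; have /andP[w0 w1] := W_itv t0; have wN0 : W t != 0 by rewrite gt_eqF.
have TN0 : T != 0 by rewrite gt_eqF.
have dW := is_derive1X 2 (is_derive_shrink T_gt0 t0).
have dV := is_derive1V (f := fun s => W s ^+ 2) (expf_neq0 2 wN0) dW.
have dv := is_derive_comp_W t0 (v_derive j w0).1.
have := is_derive1M (is_derive1Z r dV)
  (is_derive1D (is_derive_cst (xi ord0 j) t (1 : R)) dv).
rewrite (_ : (fun s => X s ord0 j) =
  (fun s => r * W s ^- 2 * (cst (xi ord0 j) s + v (W s) ord0 j))); last first.
  by apply/funext => s; rewrite !mxE.
move/is_derive1_congr; apply; rewrite !mxE /= -/(W t).
by field; rewrite ?wN0 ?TN0.
Qed.

Let X1_derive t j : 0 <= t ->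
  is_derive t 1 (fun s => X1 s ord0 j) (X2 t ord0 j).
Proof.
move=> t0; have /andP[w0 w1] := W_itv t0; have wN0 : W t != 0 by rewrite gt_eqF.
have TN0 : T != 0 by rewrite gt_eqF.
have dW := is_derive_shrink T_gt0 t0.
have dv := is_derive_comp_W t0 (v_derive j w0).1.
have dv1 := is_derive_comp_W t0 (v_derive j w0).2.
have := is_derive1Z (- (r / (3 * T))) (is_derive1B
  (is_derive1M (is_derive1X 2 dW) dv1)
  (is_derive1M (is_derive1Z 2 dW)
    (is_derive1D (is_derive_cst (xi ord0 j) t (1 : R)) dv))).
rewrite (_ : (fun s => X1 s ord0 j) = (fun s => - (r / (3 * T)) *
  (W s ^+ 2 * v1 (W s) ord0 j
    - 2 * W s * (cst (xi ord0 j) s + v (W s) ord0 j)))); last first.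
  by apply/funext => s; rewrite !mxE.
move/is_derive1_congr; apply; rewrite !mxE /= -/(W t).
by field.
Qed.

Let v_continuous w : 0 < w -> {for w, continuous v}.
Proof.
move=> w0; apply: cvg_rV => j.
exact: is_derive_continuous (v_derive j w0).1.
Qed.

Let cvg_comp_W (f : R -> 'rV[R]_d) t : 0 <= t -> {for W t, continuous f} ->
  {for t, continuous (fun s => f (W s))}.
Proof.
move=> t0 fc.
exact: (@cvg_comp _ _ _ W f _ (nbhs (W t)) _ (W_continuous t0) fc).
Qed.

Let WX_continuous n t : 0 <= t -> W s ^+ n @[s --> t] --> W t ^+ n.
Proof.
move=> t0; exact: (@cvg_comp _ _ _ W (fun u => u ^+ n) _ (nbhs (W t)) _
  (W_continuous t0) (@exprn_continuous R n (W t))).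
Qed.

Let X2_continuous t : 0 <= t -> {for t, continuous X2}.
Proof.
move=> t0; have /andP[w0 _] := W_itv t0.
apply: cvgZ.
  by apply: cvgM; [exact: cvg_cst|exact: WX_continuous].
apply: cvgB.
  apply: cvgZ; first exact: WX_continuous.
  by apply: (cvg_comp_W t0); exact: v2_continuous.
apply: cvgZ; first exact: cvg_cst.
apply: cvgD; first exact: cvg_cst.
by apply: (cvg_comp_W t0); exact: v_continuous.
Qed.

Let X_minus_centre t i : 0 <= t ->
  X t - c i t = (r * W t ^- 2) *: z i (W t).
Proof.
move=> t0; have /andP[w0 w1] := W_itv t0; have wN0 : W t != 0 by rewrite gt_eqF.
have rN0 : r != 0 by rewrite gt_eqF.
rewrite /X /z /centre clamp_id// shrink_timeK//.
by apply/rowP => j; rewrite !mxE; field; rewrite ?wN0 ?rN0.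
Qed.

Let scale_gt0 t : 0 <= t -> 0 < r * W t ^- 2.
Proof.
move=> t0; have /andP[w0 w1] := W_itv t0.
by rewrite mulr_gt0// invr_gt0 exprn_gt0.
Qed.

Let X_solution : solution m c X X1.
Proof.
exists X2; split.
- split; [exact: has_derivative_halfline_coord..|].
  apply: continuous_in_subspaceT => t; rewrite inE/= in_itv/= andbT.
  exact: X2_continuous.
- move=> t i t0 /eqP; rewrite -subr_eq0 X_minus_centre// scaler_eq0.
  rewrite gt_eqF ?scale_gt0//=; apply/negP.
  exact: dot_gt0_neq0 (@z_neq0 i _ (W_itv t0)).
- move=> t t0; have -> := @kepler_force_scale _ _ _ m c t _ (fun i => z i (W t)) (X t)
    (scale_gt0 t0) (fun i => X_minus_centre i t0).
  rewrite /X2 v_ode ?W_itv//.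
  have -> : \sum_i (m i / M) *: kepler (z i (W t)) =
      M^-1 *: \sum_i m i *: kepler (z i (W t)).
    by rewrite scaler_sumr; apply: eq_bigr => i _; rewrite [RHS]scalerA mulrC.
  have /andP[w0 w1] := W_itv t0; have wN0 : W t != 0 by rewrite gt_eqF.
  have [TN0 rN0 MN0] : [/\ T != 0, r != 0 & M != 0] by rewrite !gt_eqF.
  (* This is where the mass fixes the time scale T. *)
  have rE : r / (9 * T ^+ 2) = M / (2 * r ^+ 2).
    apply/eqP; rewrite eqr_div ?mulf_neq0 ?expf_neq0//; apply/eqP.
    by rewrite mulrCA -exprS rTM; field.
  move: (\sum_i _) => F; rewrite rE.
  by apply/rowP => j; rewrite !mxE; field; rewrite ?wN0 ?rN0 ?MN0.
Qed.
Let cvg0_of_bound (f : R -> 'rV[R]_d) (k : R) :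
  (forall t, 0 <= t -> `|f t| <= k * W t) -> f t @[t --> +oo] --> (0 : 'rV[R]_d).
Proof.
move=> fk; have kW : k * W t @[t --> +oo] --> 0.
  rewrite -(mulr0 k); apply: cvgM; [exact: cvg_cst|exact: shrink_cvg0].
move/cvgrPdist_le : kW => kW; apply/cvgrPdist_le => e e0; near=> t.
have t0 : 0 <= t by near: t; apply: nbhs_pinfty_ge; rewrite num_real.
have kWe : `|0 - k * W t| <= e by near: t; exact: kW.
rewrite sub0r normrN (le_trans (fk _ t0))// (le_trans (ler_norm _))//.
by move: kWe; rewrite sub0r normrN.
Unshelve. all: by end_near. Qed.

Let profile_cvg : xi + v (W t) @[t --> +oo] --> xi.
Proof.
rewrite -[X in _ --> X]addr0; apply: cvgD; first exact: cvg_cst.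
by apply: (@cvg0_of_bound _ delta) => t t0; rewrite v_bound ?W_itv.
Qed.

Let enorm_profile_cvg : enorm (xi + v (W t)) @[t --> +oo] --> (1 : R).
Proof.
rewrite -xi1; exact: (@cvg_comp _ _ _ (fun t => xi + v (W t)) (@enorm R d) _
  (nbhs xi) _ profile_cvg (@enorm_continuous R d xi)).
Qed.

Let enormX t : 0 <= t -> enorm (X t) = r * W t ^- 2 * enorm (xi + v (W t)).
Proof. by move=> t0; rewrite enormZ gtr0_norm// scale_gt0. Qed.

Let near_pos : \forall t \near +oo, 0 <= t :> R.
Proof. by apply: nbhs_pinfty_ge; rewrite num_real. Qed.

Let X_escapes : enorm (X t) @[t --> +oo] --> +oo.
Proof.
apply/cvgryPge => A.
have A1 : 0 < 2 * (`|A| + 1) by rewrite mulr_gt0// ltr_wpDl.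
have A0 : 0 < r / (2 * (`|A| + 1)) by rewrite divr_gt0// A1.
have wA : \forall t \near +oo, W t <= r / (2 * (`|A| + 1)).
  exact: (cvgr_le _ (shrink_cvg0 T_gt0) _ A0).
have h : 2^-1 < 1 :> R by rewrite invf_lt1// ltr1n.
have n2 : \forall t \near +oo, 2^-1 <= enorm (xi + v (W t)).
  exact: (cvgr_ge _ enorm_profile_cvg _ h).
near=> t.
have t0 : 0 <= t by near: t.
have wAt : W t <= r / (2 * (`|A| + 1)) by near: t.
have n2t : 2^-1 <= enorm (xi + v (W t)) by near: t.
have /andP[w0 w1] := W_itv t0.
rewrite enormX// (le_trans (ler_norm A))//.
have h1 : r * W t ^- 1 <= r * W t ^- 2.
  rewrite ler_wpM2l ?(ltW r_gt0)// lef_pV2 ?posrE ?exprn_gt0//.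
  by rewrite expr1 expr2 ler_piMl// ltW.
have h2 : 2 * (`|A| + 1) <= r * W t ^- 1.
  by rewrite expr1 ler_pdivlMr// mulrC -ler_pdivlMr// A1.
have : 2 * (`|A| + 1) * 2^-1 <= r * W t ^- 2 * enorm (xi + v (W t)).
  by rewrite ler_pM// ?(le_trans h2)// mulr_ge0// addr_ge0.
lra.
Unshelve. all: by end_near. Qed.

Let X1_cvg0 : X1 t @[t --> +oo] --> (0 : 'rV[R]_d).
Proof.
apply: (@cvg0_of_bound _ (r / (3 * T) * (K + 2 * (1 + delta)))) => t t0.
have w01 := W_itv t0; have /andP[w0 w1] := w01.
have a0 : 0 < r / (3 * T) by rewrite divr_gt0// mulr_gt0.
rewrite normrZ normrN (gtr0_norm a0) -mulrA ler_wpM2l ?(ltW a0)//.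
apply: (le_trans (ler_normB _ _)); rewrite (normrZ (W t ^+ 2)) (normrZ (2 * W t)).
rewrite (gtr0_norm (exprn_gt0 2 w0)) (gtr0_norm (mulr_gt0 (ltr0Sn R 1) w0)).
have delta0 : 0 <= delta.
  by have := le_trans (normr_ge0 _) (v_bound w01); rewrite pmulr_lge0.
have h1 : W t ^+ 2 * `|v1 (W t)| <= W t * K.
  by rewrite ler_pM ?exprn_ge0 ?(ltW w0) ?v1_bound// expr2 ler_piMl// ltW.
have h2 : `|xi + v (W t)| <= 1 + delta.
  rewrite (le_trans (ler_normD _ _))// lerD ?norm_unit_le1//.
  by rewrite (le_trans (v_bound w01))// ler_piMr.
have h3 : 2 * W t * `|xi + v (W t)| <= 2 * W t * (1 + delta).
  by rewrite ler_wpM2l// mulr_ge0// ltW.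
lra.
Qed.

Lemma parabolic_solution_of_profile : exists X : R -> 'rV[R]_d,
  [/\ parabolic_solution m c X,
    X 0 = r *: (xi + v 1),
    (enorm (X t))^-1 *: X t @[t --> +oo] --> xi &
    asymp_equiv (fun t => enorm (X t))
      (fun t => (9 / 2 * M) `^ (1 / 3) * t `^ (2 / 3))].
Proof.
exists X; split.
- by exists X1.
- by rewrite /X /W shrink0 expr1n invr1 mulr1.
- rewrite -[X in _ --> X]scale1r -invr1.
  have : (enorm (xi + v (W t)))^-1 *: (xi + v (W t)) @[t --> +oo]
      --> (1 : R)^-1 *: xi.
    by apply: cvgZ => //; apply: cvgV => //; exact: oner_neq0.
  apply: cvg_trans; apply: near_eq_cvg; near=> t.
  have t0 : 0 <= t by near: t.
  rewrite enormX// /X scalerA invfM mulrAC mulVf ?mul1r//.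
  by rewrite gt_eqF ?scale_gt0.
- have M9 : 0 < 9 / 2 * M by rewrite mulr_gt0// divr_gt0.
  have : r * W t ^- 2 / ((9 / 2 * M) `^ (1 / 3) * t `^ (2 / 3))
      * enorm (xi + v (W t)) @[t --> +oo] --> (1 * 1 : R).
    apply: cvgM; last exact: enorm_profile_cvg.
    exact: shrink_asymp T_gt0 r_gt0 M9 rTM.
  rewrite mulr1; apply: cvg_trans; apply: near_eq_cvg; near=> t.
  have t0 : 0 <= t by near: t.
  by rewrite /= enormX// [RHS]mulrAC.
Unshelve. all: by end_near. Qed.
End ParabolicSolution.

(** * Choice of the constants *)
Section Bounds.
Context {R : realType} {d N : nat}.

Lemma sup_enorm_common_bound (c : 'I_N -> R -> 'rV[R]_d) :
  (forall i, (sup_enorm (c i) < +oo)%E) ->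
  exists2 M : R, 0 <= M & forall i t, enorm (c i t) <= M.
Proof.
move=> cb; pose B i := fine (sup_enorm (c i)).
have le_sup i t : ((enorm (c i t))%:E <= sup_enorm (c i))%E.
  by apply: ereal_sup_ubound; exists t.
have le_B i t : enorm (c i t) <= B i.
  rewrite -lee_fin fineK// fin_real//.
  by rewrite cb andbT (lt_le_trans _ (le_sup i t))// ltNyr.
have B0 i : 0 <= B i by rewrite (le_trans _ (le_B i 0))// sqrtr_ge0.
exists (\sum_i B i) => [|i t]; first by apply: sumr_ge0.
rewrite (le_trans (le_B i t))// (bigD1 i)//= lerDl.
by apply: sumr_ge0.
Qed.

Lemma sup_enorm_lt (f : R -> 'rV[R]_d) (M r : R) :
  (forall t, enorm (f t) <= M) -> M < r -> (sup_enorm f < r%:E)%E.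
Proof.
move=> fM Mr; apply: (@le_lt_trans _ _ M%:E); last by rewrite lte_fin.
by apply: ge_ereal_sup => _ [t _ <-]; rewrite lee_fin.
Qed.

(** For unit vectors, [|y - xi|^2 = 2 - 2 <y, xi>]: the aperture of the cone is
    chosen from the wanted distance [b]. *)
Lemma cone_direction_close (xi x : 'rV[R]_d) (b r : R) : enorm xi = 1 -> 0 <= r ->
  0 <= b -> truncated_cone xi r (1 - b ^+ 2 / 2) x ->
  enorm ((enorm x)^-1 *: x - xi) <= b.
Proof.
move=> xi1 r0 b0 [rx cx]; have x0 : 0 < enorm x by exact: le_lt_trans rx.
have e1 : enorm ((enorm x)^-1 *: x) = 1.
  by rewrite enormZ gtr0_norm ?invr_gt0// mulVf// gt_eqF.
rewrite -ler_sqr ?nnegrE ?sqrtr_ge0// enorm_sqr.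
move: cx e1; move: ((enorm x)^-1 *: x) => y cy y1.
have -> : dot (y - xi) (y - xi) = enorm y ^+ 2 + enorm xi ^+ 2 - 2 * dot y xi.
  by rewrite !enorm_sqr !dotE (dotC xi y); ring.
rewrite y1 xi1; lra.
Qed.

Lemma small_parameters : (0 < d)%N -> exists delta e b : R,
  [/\ 2 * delta <= (6 * d%:R)^-1,
      32 * (1 + 2 * d%:R) * kepler_modulus d * delta <= 1,
      0 < e <= delta /\ 16 * (1 + 2 * d%:R) * (1 + 3 * d%:R) * e <= delta &
      0 < b < 1 /\ 4 * (1 + 2 * d%:R) * b <= delta].
Proof.
move=> d0; have D1 : 1 <= d%:R :> R by rewrite ler1n.
have D0 : 0 < d%:R :> R by rewrite ltr0n.
have L1 : 1 <= 1 + 2 * d%:R :> R by rewrite lerDl mulr_ge0.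
have L0 := lt_le_trans ltr01 L1.
have A1 : 1 <= 1 + 3 * d%:R :> R by rewrite lerDl mulr_ge0.
have A0 := lt_le_trans ltr01 A1.
have C0 := @kepler_modulus_gt0 R d d0.
have p : 0 < 32 * (1 + 2 * d%:R) * kepler_modulus d :> R by rewrite !mulr_gt0.
have q : 0 < 12 * d%:R :> R by rewrite mulr_gt0.
pose delta : R := Num.min (12 * d%:R)^-1 (32 * (1 + 2 * d%:R) * kepler_modulus d)^-1.
have delta0 : 0 < delta by rewrite lt_min !invr_gt0 q p.
have dq : delta <= (12 * d%:R)^-1 by rewrite ge_min lexx.
have dp : delta <= (32 * (1 + 2 * d%:R) * kepler_modulus d)^-1.
  by rewrite ge_min lexx orbT.
have delta1 : delta < 1.
  rewrite (le_lt_trans dq)// invf_lt1//; lra.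
have LA1 : 1 <= 16 * (1 + 2 * d%:R) * (1 + 3 * d%:R) :> R.
  by rewrite -mulrA mulr_ege1// ?mulr_ege1// ler1n.
have LA0 := lt_le_trans ltr01 LA1.
have LL1 : 1 <= 4 * (1 + 2 * d%:R) :> R by rewrite mulr_ege1// ler1n.
have LL0 := lt_le_trans ltr01 LL1.
exists delta, (delta / (16 * (1 + 2 * d%:R) * (1 + 3 * d%:R))),
  (delta / (4 * (1 + 2 * d%:R))); split.
- have -> : (6 * d%:R)^-1 = 2 * (12 * d%:R)^-1 :> R by field; rewrite gt_eqF.
  by rewrite ler_wpM2l.
- by rewrite mulrC -ler_pdivlMr// mul1r.
- split; last by rewrite mulrC divfK// gt_eqF.
  by rewrite divr_gt0//= ler_pdivrMr// ler_peMr// ltW.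
- split; last by rewrite mulrC divfK// gt_eqF.
  rewrite divr_gt0//= ltr_pdivrMr// mul1r (lt_le_trans delta1)//.
Qed.
End Bounds.

Theorem corollary6p1 (R : realType) (d N : nat) (hd : (2 <= d)%N) (hN : (1 <= N)%N)
    (m : 'I_N -> R) (hm : forall i : 'I_N, 0 < m i)
    (c : 'I_N -> R -> 'rV[R]_d) (hc : forall i : 'I_N, continuous (c i))
    (hbound : forall i : 'I_N, (sup_enorm (c i) < +oo)%E)
    (xi : 'rV[R]_d) (hxi : enorm xi = 1) :
  exists R' eta' : R,
    [/\ forall i : 'I_N, (sup_enorm (c i) < R'%:E)%E,
        0 < eta', eta' < 1 &
        forall x0 : 'rV[R]_d, truncated_cone xi R' eta' x0 ->
          exists x : R -> 'rV[R]_d,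
            [/\ parabolic_solution m c x,
                x 0 = x0,
                (enorm (x t))^-1 *: x t @[t --> +oo] --> xi &
                asymp_equiv (fun t : R => enorm (x t))
                  (fun t : R =>
                     (9 / 2 * \sum_(i < N) m i) `^ (1 / 3) * t `^ (2 / 3))]].
Proof.
have d0 : (0 < d)%N by exact: leq_trans hd.
have [delta [e [b [dsmall dC [/andP[e0 ed] de] [/andP[b0 b1] db]]]]] :=
  small_parameters (R := R) d0.
have [M M0 cM] := sup_enorm_common_bound hbound.
pose m_tot := \sum_(i < N) m i.
have m_tot0 : 0 < m_tot.
  rewrite /m_tot (bigD1 (Ordinal hN))//= ltr_pwDl// sumr_ge0// => i _.
  exact: ltW.
have Me0 : 0 <= M / e by rewrite divr_ge0// ltW.
have b2 : 0 < b ^+ 2 / 2 by rewrite divr_gt0// exprn_gt0.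
have b2' : b ^+ 2 / 2 < 1.
  have : b ^+ 2 < 1 by rewrite exprn_ilt1// ltW.
  by lra.
(* At distance r >= M / e the rescaled centres have norm at most M / r <= e. *)
exists (M / e + M + 1), (1 - b ^+ 2 / 2); split; [|lra|lra|].
  by move=> i; apply: (sup_enorm_lt (M := M)) => //; lra.
move=> x0 cone; have [rx _] := cone.
set r := enorm x0 in rx.
have r0 : 0 < r by lra.
(* The homothetic motion starting at distance r has been launched at time - T. *)
pose T := Num.sqrt (r ^+ 3 / (9 / 2 * m_tot)).
have m9 : 0 < 9 / 2 * m_tot by rewrite mulr_gt0// divr_gt0.
have rT : 0 < r ^+ 3 / (9 / 2 * m_tot) by rewrite divr_gt0// exprn_gt0.
have T0 : 0 < T by rewrite sqrtr_gt0.
have rTM : r ^+ 3 = 9 / 2 * m_tot * T ^+ 2.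
  by rewrite sqr_sqrtr ?(ltW rT)// mulrC divfK// gt_eqF.
(* The time t is T (w^-3 - 1) when w = shrink T t. *)
pose centre i w := r^-1 *: c i (T * (clamp w ^- 3 - 1)).
have centre_cont i w : 0 < w -> {for w, continuous (centre i)}.
  move=> w0; apply: cvgZ; first exact: cvg_cst.
  have /andP[q0 _] := clamp_itv w0.
  have tc : T * (clamp s ^- 3 - 1) @[s --> w] --> T * (clamp w ^- 3 - 1).
    apply: cvgM; first exact: cvg_cst.
    apply: cvgB; last exact: cvg_cst.
    apply: cvgV; first by rewrite expf_neq0// gt_eqF.
    exact: (@cvg_comp _ _ _ clamp (fun z => z ^+ 3) _ _ _ (@clamp_continuous R w)
      (@exprn_continuous R 3 (clamp w))).
  exact: (@cvg_comp _ _ _ (fun s => T * (clamp s ^- 3 - 1)) (c i) _ _ _ tc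
    (hc i _)).
have centre_bound i w : 0 < w -> `|centre i w| <= e.
  move=> _; rewrite normrZ gtr0_norm ?invr_gt0// mulrC ler_pdivrMr//.
  rewrite (le_trans (norm_le_enorm _))// (le_trans (cM i _))//.
  by rewrite mulrC -ler_pdivrMr//; lra.
pose mu i := m i / m_tot.
have mu0 i : 0 <= mu i by rewrite divr_ge0// ltW.
have mu1 : \sum_i mu i = 1 by rewrite -mulr_suml mulfV// gt_eqF.
have bb : 4 * (1 + 2 * d%:R) * `|r^-1 *: x0 - xi| <= delta.
  rewrite (le_trans _ db)// ler_wpM2l//.
  rewrite (le_trans (norm_le_enorm _))//.
  by apply: cone_direction_close cone => //; [lra|exact: ltW].
have e01 : 0 <= e <= delta by rewrite ltW.
have [v [v1 [v2 [vE vd v2c [K v1K] vP]]]] := reduced_problem d0 hxi mu0 mu1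
  centre_cont centre_bound e01 dsmall dC de bb.
have vb w : 0 < w <= 1 -> `|v w| <= delta * w by case/vP.
have vz i w : 0 < w <= 1 -> 0 < dot (xi + (v w - w ^+ 2 *: centre i w))
    (xi + (v w - w ^+ 2 *: centre i w)) by case/vP.
have vo w : 0 < w <= 1 -> w ^+ 2 *: v2 w = 2 *: (xi + v w
    - \sum_i mu i *: kepler (xi + (v w - w ^+ 2 *: centre i w))) by case/vP.
have [X [pX X0 Xdir Xas]] :=
  parabolic_solution_of_profile hxi r0 T0 m_tot0 rTM vd v2c v1K vb vz vo.
exists X; split=> //.
by rewrite X0 vE addrC subrK scalerA mulfV ?scale1r// gt_eqF.
Qed.
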